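(* Let $P\subset\mathbb R^3$ be a centrally symmetric convex polyhedron, and let $E(P)$ and $f_2(P)$ denote the numbers of edges and facets of $P$, respectively. Then \[ \delta(P)=\sum_{\{F,-F\}}(2e(F)-1)=2E(P)-\frac{f_2(P)}2, \] where the sum is over unordered pairs of opposite facets, $-F$ denotes the image of the facet $F$ under the central symmetry of $P$, and $e(F)$ is the number of edges of $F$.
   Context: A convex polyhedron $P\subset\mathbb R^3$ means a compact full-dimensional convex polytope. Two points of $P$ are antipodal if there are two parallel supporting planes of $P$, one through each point, that contain $P$ between them. $V(P)$ is the number of vertices of $P$; $A(P)$ is the number of unordered pairs of distinct vertices of $P$ that are antipodal; $B(P)$ is the number of unordered pairs of distinct edges of $P$ whose midpoints are antipodal. The antipodal defect is $\delta(P)=V(P)-1-A(P)+B(P)$. *)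

(* Defs.v *)
From HB Require Import structures.
From mathcomp Require Import all_boot all_order all_algebra finmap.
From mathcomp Require Import boolp classical_sets functions cardinality fsbigop.
From mathcomp Require Import reals.

Set Implicit Arguments.
Unset Strict Implicit.
Unset Printing Implicit Defensive.

Import Order.TTheory GRing.Theory Num.Theory.

Local Open Scope classical_set_scope.
Local Open Scope ring_scope.

(* Junk value: 0 when A is infinite. *)
Definition card_of (T : choiceType) (A : set T) : nat := #|` fset_set A|.

(* {a, b} with a <> b is encoded as the two-element set [set a; b]. *)
Definition unordered_pairs (T : Type) (A : set T) (r : T -> T -> Prop) :
    set (set T) :=
  [set S | exists a b, [/\ A a, A b, a <> b, r a b & S = [set a; b]]].

Section Polytopes.
Context {R : realType} {n : nat}.
Local Notation V := 'rV[R]_n.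
Implicit Types (A P F : set V) (x y m u : V).

Definition dot u x : R := \sum_(i < n) u 0 i * x 0 i.

Definition plane u (a : R) : set V := [set x | dot u x = a].

Definition affine_hull A : set V :=
  [set x | exists k (p : 'I_k -> V) (t : 'I_k -> R),
    [/\ forall i, A (p i), \sum_i t i = 1 & x = \sum_i t i *: p i]].

Definition convex_hull A : set V :=
  [set x | exists k (p : 'I_k -> V) (t : 'I_k -> R),
    [/\ forall i, A (p i), forall i, 0 <= t i, \sum_i t i = 1
      & x = \sum_i t i *: p i]].

(* The affine hull of A is a translate of a k-dimensional linear subspace;
   in particular A is nonempty. *)
Definition has_dim A (k : nat) : Prop :=
  exists x0 (U : {vspace V}),
    \dim U = k /\ affine_hull A = [set x0 + u | u in [set u | u \in U]].

Definition convex_polytope P : Prop :=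
  exists S : set V, finite_set S /\ P = convex_hull S.

Definition convex_polyhedron P : Prop := convex_polytope P /\ has_dim P n.

Definition supporting_plane P u (a : R) : Prop :=
  [/\ u != 0, forall x, P x -> dot u x <= a & exists2 x, P x & dot u x = a].

Definition face P F : Prop :=
  exists u a, supporting_plane P u a /\ F = P `&` plane u a.

Definition vertices P : set V := [set v | face P [set v]].

Definition edges P : set (set V) := [set E | face P E /\ has_dim E 1].

Definition facets P : set (set V) := [set F | face P F /\ has_dim F n.-1].

(* The planes of equation [dot u z = a] and [dot u z = b] are supporting planes
   since they touch P at x and at y. *)
Definition antipodal P x y : Prop :=
  [/\ P x, P y
    & exists u a b, [/\ u != 0, plane u a x, plane u b y
                      & forall z, P z -> a <= dot u z <= b]].

Definition midpoint_of (E : set V) m : Prop :=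
  exists a b, E = convex_hull [set a; b] /\ m = 2^-1 *: (a + b).

Definition antipodal_midpoints P (E E' : set V) : Prop :=
  exists m m', [/\ midpoint_of E m, midpoint_of E' m' & antipodal P m m'].

Definition num_vertices P : nat := card_of (vertices P).

(* Also used for a facet F: its edges are then the edges of F as a polytope
   in its own right. *)
Definition num_edges P : nat := card_of (edges P).

Definition num_facets P : nat := card_of (facets P).

Definition num_antipodal_vertices P : nat :=
  card_of (unordered_pairs (vertices P) (antipodal P)).

Definition num_antipodal_edges P : nat :=
  card_of (unordered_pairs (edges P) (antipodal_midpoints P)).

Definition antipodal_defect P : int :=
  (num_vertices P)%:Z - 1 - (num_antipodal_vertices P)%:Z
  + (num_antipodal_edges P)%:Z.

Definition point_reflection (c x : V) : V := c *+ 2 - x.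

Definition centrally_symmetric (c : V) P : Prop :=
  point_reflection c @` P = P.

(* The unordered pairs {F, -F}. *)
Definition opposite_facets (c : V) P : set (set (set V)) :=
  [set [set F; point_reflection c @` F] | F in facets P].

End Polytopes.

(* Main.v *)
(* For a vertex v and a vertex w the pair {v, w} is antipodal iff v and -w share
   a facet, and similarly for midpoints of edges; two vertices (edges) sharing a
   facet share exactly one, unless the vertices span an edge, which lies in
   exactly two facets. Counting incidences gives
     2 A + 4 E = sum_F e(F)^2 + V  and  2 B + E = sum_F e(F)^2,
   so that 2 delta = 2 V - 2 + 3 E - V, which Euler's formula turns into
   4 E - f_2 = sum_F (2 e(F) - 1).

   An edge lies in two facets, a vertex of a facet lies in two of its edges, and
   a vertex v that is not extreme for a generic functional u lies in two facets
   with points on both sides of v: in each case the two faces are those where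
   the slope of a pencil of functionals over a finite spanning set of P is
   maximal and minimal. Euler's formula follows from the third fact by double
   counting. *)

Require Import Defs.
From HB Require Import structures.
From mathcomp Require Import all_boot all_order all_algebra finmap.
From mathcomp Require Import boolp classical_sets functions cardinality fsbigop.
From mathcomp Require Import reals.
From mathcomp Require Import ring lra zify.

Set Implicit Arguments.
Unset Strict Implicit.
Unset Printing Implicit Defensive.

Import Order.TTheory GRing.Theory Num.Theory.

Local Open Scope classical_set_scope.
Local Open Scope ring_scope.

(** * Dot and cross products *)

(** Central symmetry turns antipodality into incidence: the values of a functional on P are
    symmetric about its value at the centre, so the supporting plane through y opposite to the one
    through x reflects to the latter, and x and the reflection of y lie on a common face, which
    extends to a facet. No point of a face has its reflection there too, so ordered antipodal pairs
    of vertices correspond to all ordered pairs sharing a facet, equal pairs included. Double sums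
    therefore run over full squares, and their diagonals produce the corrections in V and E. The sum
    of e(F)^2 is the same for vertices and for edges and cancels, leaving linear counts only.
    Supporting planes, faces and dimensions are all tested on a finite generating list, so extremal
    slopes are maxima over lists. *)

Lemma dotE3 (R : realType) (u x : 'rV[R]_3) :
  dot u x = u 0 0 * x 0 0 + u 0 1 * x 0 1 + u 0 2 * x 0 2.
Proof.
rewrite /dot !big_ord_recl big_ord0 addr0 addrA.
by congr (_ + _ * _ + _ * _); congr fun_of_matrix; apply: val_inj.
Qed.

Lemma row3P (R : realType) (x y : 'rV[R]_3) :
  x 0 0 = y 0 0 -> x 0 1 = y 0 1 -> x 0 2 = y 0 2 -> x = y.
Proof.
move=> h0 h1 h2; apply/rowP => -[[|[|[|//]]] hi].
- by have -> : Ordinal hi = 0 by apply: val_inj.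
- by have -> : Ordinal hi = 1 by apply: val_inj.
- by have -> : Ordinal hi = 2 by apply: val_inj.
Qed.

Section Dot.
Context {R : realType} {n : nat}.
Implicit Types (u v x y : 'rV[R]_n) (k : R).

Lemma dotC u x : dot u x = dot x u.
Proof. by apply: eq_bigr => i _; rewrite mulrC. Qed.

Lemma dotDr u x y : dot u (x + y) = dot u x + dot u y.
Proof. by rewrite /dot -big_split; apply: eq_bigr => i _; rewrite mxE mulrDr. Qed.

Lemma dotZr u k x : dot u (k *: x) = k * dot u x.
Proof. by rewrite /dot mulr_sumr; apply: eq_bigr => i _; rewrite mxE mulrCA. Qed.

Lemma dotNr u x : dot u (- x) = - dot u x.
Proof. by rewrite -scaleN1r dotZr mulN1r. Qed.

Lemma dotBr u x y : dot u (x - y) = dot u x - dot u y.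
Proof. by rewrite dotDr dotNr. Qed.

Lemma dotDl u v x : dot (u + v) x = dot u x + dot v x.
Proof. by rewrite ![dot _ x]dotC dotDr. Qed.

Lemma dotZl k u x : dot (k *: u) x = k * dot u x.
Proof. by rewrite ![dot _ x]dotC dotZr. Qed.

Lemma dotNl u x : dot (- u) x = - dot u x.
Proof. by rewrite ![dot _ x]dotC dotNr. Qed.

Lemma dotBl u v x : dot (u - v) x = dot u x - dot v x.
Proof. by rewrite dotDl dotNl. Qed.

Lemma dot0l x : dot 0 x = 0.
Proof. by rewrite /dot big1 // => i _; rewrite mxE mul0r. Qed.

Lemma dot0r u : dot u 0 = 0.
Proof. by rewrite dotC dot0l. Qed.

Lemma dot_sumr u I (r : seq I) (F : I -> 'rV[R]_n) :
  dot u (\sum_(i <- r) F i) = \sum_(i <- r) dot u (F i).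
Proof.
by elim: r => [|i r IH]; rewrite ?big_nil ?dot0r // !big_cons dotDr IH.
Qed.

Lemma dot_ge0 u : 0 <= dot u u.
Proof. by apply: sumr_ge0 => i _; rewrite -expr2 sqr_ge0. Qed.

Lemma dot_eq0 u : (dot u u == 0) = (u == 0).
Proof.
apply/eqP/eqP => [h|->]; last exact: dot0l.
apply/rowP => i; rewrite mxE; apply/eqP; rewrite -sqrf_eq0 expr2; apply/eqP.
move: h; rewrite /dot => /psumr_eq0P; apply => // j _.
by rewrite -expr2 sqr_ge0.
Qed.

Lemma dot_gt0 u : u != 0 -> 0 < dot u u.
Proof. by move=> u0; rewrite lt_neqAle dot_ge0 eq_sym dot_eq0 u0. Qed.

End Dot.

Section Cross.
Context {R : realType}.
Implicit Types (d u v w x y : 'rV[R]_3).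

Definition cross u v : 'rV[R]_3 :=
  \row_(i < 3) [:: u 0 1 * v 0 2 - u 0 2 * v 0 1;
                   u 0 2 * v 0 0 - u 0 0 * v 0 2;
                   u 0 0 * v 0 1 - u 0 1 * v 0 0]`_i.

Lemma crossE u v :
  (cross u v 0 0 = u 0 1 * v 0 2 - u 0 2 * v 0 1) *
  (cross u v 0 1 = u 0 2 * v 0 0 - u 0 0 * v 0 2) *
  (cross u v 0 2 = u 0 0 * v 0 1 - u 0 1 * v 0 0).
Proof. by rewrite !mxE. Qed.

Ltac coord := rewrite ?(dotE3, crossE, mxE) /=.

Lemma dot_crossl u v : dot u (cross u v) = 0.
Proof. by coord; ring. Qed.

Lemma dot_crossr u v : dot v (cross u v) = 0.
Proof. by coord; ring. Qed.

Lemma cross_eq0 u v : u != 0 -> cross u v = 0 -> v = (dot u v / dot u u) *: u.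
Proof.
move=> u0 c0; have hu := lt0r_neq0 (dot_gt0 u0).
have triple : dot u u *: v = dot u v *: u - cross u (cross u v).
  by apply: row3P; coord; ring.
apply: (scalerI hu); rewrite scalerA mulrCA mulfV // mulr1 triple c0.
by apply: row3P; coord; ring.
Qed.

(** Cramer's rule in the basis [d], [w], [cross d w], whose determinant is the squared norm of
    [cross d w]. *)
Lemma cross_basis d w x : cross d w != 0 ->
  x = (dot (cross x w) (cross d w) / dot (cross d w) (cross d w)) *: d
    + (dot (cross d x) (cross d w) / dot (cross d w) (cross d w)) *: w
    + (dot x (cross d w) / dot (cross d w) (cross d w)) *: cross d w.
Proof.
move=> n0; have hn := lt0r_neq0 (dot_gt0 n0).
have e : dot (cross d w) (cross d w) *: x =
    dot (cross x w) (cross d w) *: d + dot (cross d x) (cross d w) *: w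
    + dot x (cross d w) *: cross d w by apply: row3P; coord; ring.
apply: (scalerI hn); rewrite e !scalerDr !scalerA.
by congr (_ + _ + _); congr (_ *: _); field.
Qed.

Lemma cross_perp_eq0 d w : d != 0 -> dot w d = 0 -> cross d w = 0 -> w = 0.
Proof. by move=> d0 wd /(cross_eq0 d0); rewrite dotC wd mul0r scale0r. Qed.

(** The functionals constant along [d] form a plane with orthogonal basis [w], [cross d w]; this
    places the normal of any face through a line of direction [d] in the pencil at hand. *)
Lemma pencil_perp d w m : d != 0 -> w != 0 -> dot w d = 0 -> dot m d = 0 ->
  exists a b, m = a *: w + b *: cross d w.
Proof.
move=> d0 w0 wd md.
have n0 : cross d w != 0.
  by apply: contra_neq w0; apply: cross_perp_eq0.
exists (dot (cross d m) (cross d w) / dot (cross d w) (cross d w)).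
exists (dot m (cross d w) / dot (cross d w) (cross d w)).
rewrite {1}(cross_basis m n0).
suff -> : dot (cross m w) (cross d w) = 0 by rewrite mul0r scale0r add0r.
have -> : dot (cross m w) (cross d w) = dot m d * dot w w - dot m w * dot w d.
  by coord; ring.
by rewrite md wd; ring.
Qed.

(** The vectors orthogonal to two independent ones form a line, so three noncollinear points fix the
    normal of their plane up to scale. *)
Lemma perp_cross p q m : cross p q != 0 -> dot m p = 0 -> dot m q = 0 ->
  exists k, m = k *: cross p q.
Proof.
move=> n0 mp mq.
exists (dot m (cross p q) / dot (cross p q) (cross p q)).
rewrite {1}(cross_basis m n0).
have -> : dot (cross m q) (cross p q) = dot m p * dot q q - dot m q * dot q p.
  by coord; ring.
have -> : dot (cross p m) (cross p q) = dot p p * dot m q - dot m p * dot p q.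
  by coord; ring.
by rewrite mp mq !(mul0r, mulr0) subrr !mul0r !scale0r !add0r.
Qed.

Lemma plane_cross p q m x : cross p q != 0 -> m != 0 ->
  dot m p = 0 -> dot m q = 0 -> dot m x = 0 -> exists a b, x = a *: p + b *: q.
Proof.
move=> n0 m0 mp mq mx; have [k mE] := perp_cross n0 mp mq.
have k0 : k != 0 by apply: contra_neq m0 => k0; rewrite mE k0 scale0r.
exists (dot (cross x q) (cross p q) / dot (cross p q) (cross p q)).
exists (dot (cross p x) (cross p q) / dot (cross p q) (cross p q)).
rewrite {1}(cross_basis x n0).
suff -> : dot x (cross p q) = 0 by rewrite mul0r scale0r addr0.
by apply: (mulfI k0); rewrite mulr0 dotC -dotZl -mE.
Qed.

End Cross.

(** * Faces of the convex hull of a finite set *)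

Section Hull.
Context {R : realType} {n : nat}.
Local Notation V := 'rV[R]_n.
Implicit Types (A B F G P : set V) (S : seq V) (a b s u v w x y z : V).

Lemma sub_convex_hull A x : A x -> convex_hull A x.
Proof.
move=> Ax; exists 1%N, (fun=> x), (fun=> 1); split => //.
- by rewrite big_ord1.
- by rewrite big_ord1 scale1r.
Qed.

Lemma convex_hull_mono A B : A `<=` B -> convex_hull A `<=` convex_hull B.
Proof. by move=> AB x [k [p [t [Ap t0 t1 ->]]]]; exists k, p, t; split => // i; apply: AB. Qed.

Lemma convex_hull_le A u (c : R) x :
  (forall s, A s -> dot u s <= c) -> convex_hull A x -> dot u x <= c.
Proof.
move=> Ac [k [p [t [Ap t0 t1 ->]]]]; rewrite dot_sumr -[c]mul1r -t1 mulr_suml.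
by apply: ler_sum => i _; rewrite dotZr ler_wpM2l // Ac.
Qed.

(** An average of values at most [c] equals [c] only if every point of nonzero weight attains
    [c]. *)
Lemma convex_hull_tight A u (c : R) x :
    (forall s, A s -> dot u s <= c) -> convex_hull A x -> dot u x = c ->
  convex_hull (A `&` plane u c) x.
Proof.
move=> Ac [k [p [t [Ap t0 t1 xE]]]] xc.
have tight i : t i != 0 -> dot u (p i) = c.
  move=> ti; have : \sum_i t i * (c - dot u (p i)) = 0.
    under eq_bigr => j _ do rewrite mulrBr.
    rewrite sumrB -mulr_suml t1 mul1r -[X in X - _]xc xE dot_sumr.
    by apply/eqP; rewrite subr_eq0; apply/eqP; apply: eq_bigr => j _; rewrite dotZr.
  move/psumr_eq0P => /(_ _ i isT) H.
  have /eqP : t i * (c - dot u (p i)) = 0.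
    by apply: H => j _; rewrite mulr_ge0 // subr_ge0 Ac.
  by rewrite mulf_eq0 (negbTE ti) subr_eq0 => /eqP.
have [i0 ti0] : exists i, t i != 0.
  apply: contrapT => /forallNP h; have : \sum_i t i = 0.
    by rewrite big1 // => i _; apply/eqP; have := h i; case: (t i == 0).
  by rewrite t1; apply/eqP; rewrite oner_eq0.
(* Points of weight zero may miss the plane; [p i0], a point of nonzero weight, replaces them. *)
exists k, (fun i => if t i == 0 then p i0 else p i), t; split => //.
- by move=> i; case: ifP => [_|/negbT ti]; split; rewrite /plane /= ?tight.
- by rewrite xE; apply: eq_bigr => i _; case: ifP => // /eqP ->; rewrite !scale0r.
Qed.

Lemma convex_hull2P a b x : convex_hull [set a; b] x <->
  exists t : R, 0 <= t <= 1 /\ x = a + t *: (b - a).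
Proof.
split=> [[k [p [t [Ap t0 t1 ->]]]]|[t [/andP[t0 t1] ->]]].
  exists (\sum_(i | p i == b) t i); split.
    rewrite sumr_ge0 //= -t1 [leRHS](bigID (fun i => p i == b)) /= lerDl.
    exact: sumr_ge0.
  have -> : \sum_i t i *: p i = a + \sum_i t i *: (p i - a).
    under [X in _ = _ + X]eq_bigr => i _ do rewrite scalerBr.
    by rewrite sumrB -scaler_suml t1 scale1r addrC subrK.
  congr (_ + _); rewrite scaler_suml [RHS]big_mkcond; apply: eq_bigr => i _ /=.
  case: eqP => [->//|pb]; case: (Ap i) => [->|//].
  by rewrite subrr scaler0.
exists 2%N, (fun i : 'I_2 => if i == 0 then a else b).
exists (fun i : 'I_2 => if i == 0 then 1 - t else t).
rewrite !big_ord_recl !big_ord0 /=; split.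
- by move=> i; case: ifP; [left|right].
- by move=> i; case: ifP; rewrite // subr_ge0.
- by rewrite addr0 subrK.
- by rewrite addr0 scalerBl scale1r scalerBr -addrA [- _ + _]addrC.
Qed.

Lemma convex_hull1 a : convex_hull [set a] = [set a].
Proof.
apply/seteqP; split=> [x|x ->]; last exact: sub_convex_hull.
move=> hx; have /convex_hull2P[t [_ ->]] : convex_hull [set a; a] x by rewrite setUid.
by rewrite subrr scaler0 addr0.
Qed.

Lemma sub_affine_hull A x : A x -> affine_hull A x.
Proof.
move=> Ax; exists 1%N, (fun=> x), (fun=> 1); split => //.
- by rewrite big_ord1.
- by rewrite big_ord1 scale1r.
Qed.

Lemma affine_hull_sub A x0 (W : {vspace V}) x :
  (forall y, A y -> y - x0 \in W) -> affine_hull A x -> x - x0 \in W.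
Proof.
move=> AW [k [p [t [Ap t1 ->]]]].
have -> : \sum_i t i *: p i - x0 = \sum_i t i *: (p i - x0).
  under [RHS]eq_bigr => i _ do rewrite scalerBr.
  by rewrite sumrB -scaler_suml t1 scale1r.
by apply: memv_suml => i _; rewrite memvZ // AW.
Qed.

(** [has_dim] hides its base point. Any point of [A] can serve, and the direction space is then the
    least one containing the differences, so dimensions are bounded without computing an affine
    hull. *)
Lemma has_dim_elim A k x0 : has_dim A k -> A x0 ->
  exists U : {vspace V}, [/\ \dim U = k, forall x, A x -> x - x0 \in U
    & forall W : {vspace V}, (forall x, A x -> x - x0 \in W) -> (U <= W)%VS].
Proof.
move=> [y [U [dU AU]]] Ax0; exists U.
have [u0 u0U yu0] : [set y + u | u in [set u | u \in U]] x0.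
  by rewrite -AU; apply: sub_affine_hull.
split=> // [x Ax|W AW].
  have [u uU <-] : [set y + u | u in [set u | u \in U]] x.
    by rewrite -AU; apply: sub_affine_hull.
  by rewrite -yu0 opprD addrACA subrr add0r rpredB.
apply/subvP => u uU.
suff : (x0 + u) - x0 \in W by rewrite addrC addKr.
apply: (affine_hull_sub AW); rewrite AU; exists (u0 + u); first exact: rpredD.
by rewrite addrA yu0.
Qed.

Lemma has_dim_intro A x0 (ds : seq V) : A x0 -> free ds ->
    (forall d, d \in ds -> A (x0 + d)) -> (forall x, A x -> x - x0 \in <<ds>>%VS) ->
  has_dim A (size ds).
Proof.
move=> Ax0 fds Ads AW; exists x0, <<ds>>%VS; split; first exact/eqP.
apply/seteqP; split=> [x Ax|_ [u uds <-]].
  by exists (x - x0); [apply: (affine_hull_sub AW)|rewrite addrC subrK].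
pose t i := coord (in_tuple ds) i u.
exists (size ds).+1, (fun i => if unlift ord0 i is Some j then x0 + ds`_j else x0).
exists (fun i => if unlift ord0 i is Some j then t j else 1 - \sum_j t j).
split.
- by move=> i; case: unliftP => [j|] _ //; apply: Ads; rewrite mem_nth.
- rewrite big_ord_recl unlift_none [X in _ + X](eq_bigr t) ?subrK // => i _.
  by rewrite liftK.
- rewrite big_ord_recl unlift_none.
  rewrite [X in _ = _ + X](eq_bigr (fun i => t i *: x0 + t i *: ds`_i)); last first.
    by move=> i _; rewrite liftK scalerDr.
  rewrite big_split /= -scaler_suml addrA -scalerDl subrK scale1r.
  by rewrite [in LHS](coord_span (X := in_tuple ds) uds).
Qed.

End Hull.

(** * The face relation: finiteness, transitivity, restriction and intersection *)

Section Faces.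
Context {R : realType} {n : nat}.
Local Notation V := 'rV[R]_n.
Implicit Types (A B F G P : set V) (S : seq V) (s u v w x y z : V) (a b : R).

(** A linear functional is maximal over a hull at some generator, so being a supporting plane is a
    finite condition on the list [S]. *)
Definition supports S u a := [/\ u != 0, {in S, forall s, dot u s <= a}
  & exists2 s, s \in S & dot u s = a].

Lemma supporting_hull S u a :
  supporting_plane (convex_hull [set` S]) u a <-> supports S u a.
Proof.
split=> [[u0 le [x Px xa]]|[u0 le [s sS sa]]].
  have le' : {in S, forall s, dot u s <= a}.
    by move=> s sS; apply/le/sub_convex_hull.
  split=> //.
  have [k [p [t [pA _ t1 _]]]] := convex_hull_tight le' Px xa.
  case: k => [|k] in p t pA t1 *.
    by move: t1; rewrite big_ord0 => /esym/eqP; rewrite oner_eq0.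
  by case: (pA ord0) => ? ?; exists (p ord0).
split=> //; first by move=> x; apply: convex_hull_le.
by exists s => //; apply: sub_convex_hull.
Qed.

Lemma face_hull S F : face (convex_hull [set` S]) F <->
  exists u a, supports S u a /\ F = convex_hull [set` S] `&` plane u a.
Proof.
by split=> -[u [a [/supporting_hull h ->]]]; exists u, a.
Qed.

Lemma supports_tight S u a : supports S u a ->
  convex_hull [set` S] `&` plane u a = convex_hull ([set` S] `&` plane u a).
Proof.
move=> [_ le _]; apply/seteqP; split=> [x [Px xa]|x hx].
  exact: convex_hull_tight.
split; first by apply: convex_hull_mono hx => ? [].
apply/eqP; rewrite eq_le; apply/andP; split.
  by apply: convex_hull_le hx => s [/le].
rewrite -lerN2 -dotNl; apply: convex_hull_le hx => s [_ sa].
by rewrite dotNl sa.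
Qed.

Lemma face_sub P F : face P F -> F `<=` P.
Proof. by move=> [u [a [_ ->]]] x []. Qed.

(** Only generators on the supporting plane contribute to its points. A face is thus again the hull
    of a list, to which every lemma on such hulls applies, and it is determined by a sublist of
    [S]. *)
Lemma face_pts S F : face (convex_hull [set` S]) F ->
  F = convex_hull [set` [seq s <- S | `[< F s >]]].
Proof.
move=> /face_hull[u [a [h FE]]]; rewrite {1}FE supports_tight //; congr convex_hull.
apply/seteqP; split=> s /=; rewrite mem_filter.
  by move=> [sS sa]; rewrite sS andbT; apply/asboolP; rewrite FE; split => //;
    apply: sub_convex_hull.
by move=> /andP[/asboolP]; rewrite FE => -[].
Qed.

Lemma face_ext S F G : face (convex_hull [set` S]) F -> face (convex_hull [set` S]) G ->
  {in S, forall s, F s <-> G s} -> F = G.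
Proof.
move=> /face_pts FE /face_pts GE FG; rewrite FE GE.
rewrite (@eq_in_filter _ _ (fun s => `[< G s >]) S) // => s sS.
exact/asbool_equiv_eq/FG.
Qed.

Lemma finite_faces S : finite_set (face (convex_hull [set` S])).
Proof.
apply: (@sub_finite_set _ _ ((fun m : (size S).-tuple bool =>
  convex_hull [set` mask m S]) @` setT)).
  move=> F hF; have hs : size [seq `[< F s >] | s <- S] == size S by rewrite size_map.
  exists (Tuple hs) => //=.
  by rewrite [RHS](face_pts hF) filter_mask.
exact/finite_image/finite_finset.
Qed.

Lemma finite_pred_faces S (Q : set (set V)) :
  finite_set [set F | face (convex_hull [set` S]) F /\ Q F].
Proof. by apply: sub_finite_set (finite_faces S) => F []. Qed.

(** A singleton face is the hull of the generators on its plane, so the vertex is itself a generator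
    and the others lie strictly on one side. [w] is an inner normal: [v] is its strict minimiser. *)
Lemma vertexP S v : vertices (convex_hull [set` S]) v <->
  exists w, [/\ w != 0, v \in S & {in S, forall s, s != v -> 0 < dot w (s - v)}].
Proof.
split=> [/face_hull[u [a [[u0 le [s sS sa]] E]]]|[w [w0 vS lt]]].
  have Es x : x \in S -> dot u x = a -> x = v.
    move=> xS xa; have : [set v] x by rewrite E; split => //; apply: sub_convex_hull.
    by [].
  have sv := Es s sS sa; rewrite -sv in Es *.
  exists (- u); rewrite oppr_eq0; split=> // x xS xs.
  rewrite dotNl dotBr opprB subr_gt0 sa lt_neqAle le // andbT.
  by apply: contra_neq xs; apply: Es.
have lt' : supports S (- w) (- dot w v).
  split; rewrite ?oppr_eq0 //; last by exists v; rewrite ?dotNl.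
  move=> s sS; rewrite dotNl lerN2; have [->//|sv] := eqVneq s v.
  by rewrite -subr_ge0 -dotBr ltW // lt.
apply/face_hull; exists (- w), (- dot w v); split=> //.
rewrite supports_tight // -[LHS]convex_hull1; congr convex_hull.
apply/seteqP; split=> [_ -> /=|s [/= sS]]; first by rewrite /plane /= dotNl.
rewrite /plane /= dotNl => /oppr_inj sv; apply: contrapT => /eqP nsv.
by have := lt _ sS nsv; rewrite dotBr sv subrr ltxx.
Qed.

(* On [F = P `&` plane u a] the functional [m + K u] agrees with [m] up to a
   constant, and for large [K] it is smaller everywhere else. *)
Lemma face_trans S F G : face (convex_hull [set` S]) F -> face F G ->
  face (convex_hull [set` S]) G.
Proof.
move=> hF; rewrite {1}(face_pts hF).
have [u [a [[u0 le [s0 s0S s0a]] FE]]] := (face_hull _ _).1 hF.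
move=> /face_hull[m [b [[m0 mle [s1 s1F s1b]] ->]]].
have FP s : s \in S -> F s <-> dot u s = a.
  by move=> sS; rewrite FE; split => [[]//|sa]; split => //; apply: sub_convex_hull.
have mle' s : s \in S -> dot u s = a -> dot m s <= b.
  by move=> sS /(FP _ sS).2 Fs; apply: mle; rewrite mem_filter sS andbT; apply/asboolP.
have [K0 hK0] : exists K0, forall K, K0 <= K ->
    forall s, s \in S -> dot u s < a -> dot m s + K * dot u s < b + K * a.
  elim: (S) => [|s S' [K0 IH]]; first by exists 0.
  (* At the quotient the two sides balance for [s]; adding 1 makes the inequality strict, and the
     maximum keeps the earlier points. *)
  exists (Num.max K0 ((dot m s - b) / (a - dot u s) + 1)) => K.
  rewrite ge_max => /andP[K0K hK] x; rewrite inE => /orP[/eqP->|xS']; last exact: IH.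
  rewrite -subr_gt0 => sa.
  have : (dot m s - b) / (a - dot u s) < K by lra.
  by rewrite ltr_pdivrMr //; lra.
(* Since [u] is nonzero, [m + K *: u] vanishes for at most one [K]; if that is [K0], then [K0 + 1]
   serves. *)
have [K [K0K w0]] : exists K, K0 <= K /\ m + K *: u != 0.
  have [mK0|] := eqVneq (m + K0 *: u) 0; last by exists K0.
  exists (K0 + 1); rewrite lerDl ler01; split=> //.
  by rewrite scalerDl scale1r addrA mK0 add0r.
have s1S : s1 \in S by move: s1F; rewrite mem_filter => /andP[].
have s1a : dot u s1 = a.
  by apply/FP => //; move: s1F; rewrite mem_filter => /andP[/asboolP].
have sup : supports S (m + K *: u) (b + K * a).
  split=> //; last by exists s1 => //; rewrite dotDl dotZl s1b s1a.
  move=> s sS; rewrite dotDl dotZl.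
  have [sa|sa] := eqVneq (dot u s) a; first by rewrite sa lerD2r mle'.
  by apply/ltW/hK0 => //; rewrite lt_neqAle sa le.
apply/face_hull; exists (m + K *: u), (b + K * a); split=> //.
rewrite -(face_pts hF) [in RHS]supports_tight // [in LHS](face_pts hF) supports_tight;
  last first.
  by split=> //; exists s1.
congr convex_hull; apply/seteqP; split=> s /=.
  move=> []; rewrite mem_filter => /andP[/asboolP Fs sS] sb; split=> //.
  by move/FP: Fs; rewrite /plane /= dotDl dotZl sb => ->.
rewrite mem_filter => -[sS]; rewrite /plane /= dotDl dotZl => h.
have sa : dot u s = a.
  apply: contrapT => /eqP nsa; have : dot u s < a by rewrite lt_neqAle nsa le.
  by move=> /(hK0 K K0K s sS); rewrite h ltxx.
split; last by move: h; rewrite sa; apply: addIr.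
by rewrite sS andbT; apply/asboolP/FP.
Qed.

(** Converse of transitivity: the functional cutting [G] from [P] also cuts it from [F]. *)
Lemma face_restrict P F G : face P G -> F `<=` P -> G `<=` F -> face F G.
Proof.
move=> [u [a [[u0 le [x Px xa]] GE]]] FP GF; exists u, a; split.
  split=> //; first by move=> y /FP /le.
  by exists x => //; apply: GF; rewrite GE.
apply/seteqP; split=> y; first by move=> Gy; split; [apply: GF|move: Gy; rewrite GE => -[]].
by move=> [/FP Py ya]; rewrite GE.
Qed.

(** Full dimension in dual form, in which degenerate pencils are excluded. *)
Definition full_dim P := forall u a, (forall x, P x -> dot u x = a) -> u = 0.

Lemma has_dim_full P : has_dim P n -> full_dim P.
Proof.
move=> [y [U [dU AU]]] u a Pu.
have aff x : affine_hull P x -> dot u x = a.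
  move=> [k [p [t [Pp t1 ->]]]]; rewrite dot_sumr -[a]mul1r -t1 mulr_suml.
  by apply: eq_bigr => i _; rewrite dotZr Pu.
have Uf : U = fullv.
  by apply/eqP; rewrite eqEdim subvf dimvf dU /dim /= mul1n leqnn.
have hy x : dot u (y + x) = a.
  by apply: aff; rewrite AU; exists x => //=; rewrite Uf memvf.
apply/eqP; rewrite -dot_eq0; apply/eqP.
by have := hy u; have := hy 0; rewrite !dotDr dot0r => <- /addrI.
Qed.

Lemma full_dim_pts S u a : full_dim (convex_hull [set` S]) ->
  {in S, forall s, dot u s = a} -> u = 0.
Proof.
move=> full hS; apply: (full u a) => x Px; apply/eqP; rewrite eq_le; apply/andP; split.
  by apply: convex_hull_le Px => s /hS ->.
by rewrite -lerN2 -dotNl; apply: convex_hull_le Px => s /hS; rewrite dotNl => ->.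
Qed.

(** The sum of the two functionals is maximal exactly where both are, the common point [x] showing
    that the bound is reached. It is nonzero: opposite normals would confine [P] to a plane. *)
Lemma face_inter P F G x : full_dim P -> face P F -> face P G -> F x -> G x ->
  face P (F `&` G).
Proof.
move=> full [u [a [[u0 ule _] FE]]] [v [b [[v0 vle _] GE]]].
rewrite FE GE => -[Px xu] [_ xv].
exists (u + v), (a + b); split; last first.
  apply/seteqP; split=> y; first by move=> [[Py yu] [_ yv]]; split;
    rewrite /plane /= ?dotDl ?yu ?yv.
  move=> [Py]; rewrite /plane /= dotDl => h; have := ule _ Py; have := vle _ Py => h1 h2.
  by do !split=> //; rewrite /plane /=; lra.
split; last by exists x => //; rewrite dotDl xu xv.
  apply/negP => /eqP /(canRL (addrK v)); rewrite sub0r => uv.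
  suff : u = 0 by apply/eqP.
  apply: (full u a) => y Py; apply/eqP; rewrite eq_le ule //=.
  rewrite -xu uv !dotNl lerN2 xv; exact: vle.
by move=> y Py; rewrite dotDl lerD // ?ule ?vle.
Qed.

End Faces.

(** * Pencils of functionals *)

Section Pencil.
Context {R : realType}.

Lemma seq_argmax (T : eqType) (s : seq T) (f : T -> R) x0 : x0 \in s ->
  exists2 x, x \in s & {in s, forall y, f y <= f x}.
Proof.
elim: s x0 => // z s IH x0 _; case: s IH => [_|z' s IH].
  by exists z; rewrite ?mem_head // => y; rewrite inE => /eqP ->.
have [x xs hx] := IH z' (mem_head _ _).
have [zx|xz] := leP (f z) (f x).
  exists x; first by rewrite inE xs orbT.
  by move=> y; rewrite inE => /orP[/eqP->|/hx].
exists z; rewrite ?mem_head // => y; rewrite inE => /orP[/eqP->//|/hx yx].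
exact: le_trans yx (ltW xz).
Qed.

Section Any.
Context {n : nat}.
Local Notation V := 'rV[R]_n.
Implicit Types (S : seq V) (F G P : set V) (u v w x y : V) (a b c t : R).

(** Tilting a plane about its contact set: [t] is the largest slope
    [(dot w s - dot w v) / (c - dot u s)] over the generators off the plane, hence the least tilt
    for which [v] is maximal, and a generator [x] of largest slope is a new contact point. *)
Lemma supports_extend S u c v w x0 : supports S u c ->
    v \in S -> dot u v = c -> {in S, forall s, dot u s = c -> dot w s = dot w v} ->
    x0 \in S -> dot u x0 < c -> (forall t, w + t *: u != 0) ->
  exists t x, [/\ x \in S, dot u x < c,
    supports S (w + t *: u) (dot (w + t *: u) v)
    & dot (w + t *: u) x = dot (w + t *: u) v].
Proof.
move=> [u0 le _] vS vc wv x0S x0c ind.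
have [|x] := @seq_argmax _ [seq s <- S | dot u s < c]
    (fun s => (dot w s - dot w v) / (c - dot u s)) x0.
  by rewrite mem_filter x0c.
rewrite mem_filter => /andP[xc xS] hx.
pose t := (dot w x - dot w v) / (c - dot u x).
have ht s : s \in S -> dot (w + t *: u) s <= dot (w + t *: u) v.
  move=> sS; rewrite !dotDl !dotZl vc.
  have [sc|nsc] := eqVneq (dot u s) c; first by rewrite sc wv.
  have sc : dot u s < c by rewrite lt_neqAle nsc le.
  have := hx s; rewrite mem_filter sc sS => /(_ isT).
  by rewrite -/t ler_pdivrMr ?subr_gt0 //; lra.
exists t, x; split=> //; first by split=> //; exists v.
rewrite !dotDl !dotZl vc.
have : t * (c - dot u x) = dot w x - dot w v by rewrite divfK // gt_eqF // subr_gt0.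
lra.
Qed.

Lemma supports_scale S F m a k v : F = convex_hull [set` S] `&` plane m a -> F v ->
  k != 0 -> F = convex_hull [set` S] `&` plane (k *: m) (dot (k *: m) v).
Proof.
move=> -> [_ va] k0; apply/seteqP; split=> x [Px]; rewrite /plane /= !dotZl va.
  by move=> ->.
by move/(mulfI k0).
Qed.

(* The faces cut out by functionals of the pencil spanned by [u] and [w] are
   those where the slope [w/u] is extremal. *)
Lemma pencil_two S u c v w x0 (P := convex_hull [set` S]) : supports S u c ->
    v \in S -> dot u v = c -> {in S, forall s, dot u s = c -> dot w s = dot w v} ->
    x0 \in S -> dot u x0 < c ->
    (forall a b e, {in S, forall s, dot (a *: u + b *: w) s = e} -> a = 0 /\ b = 0) ->
  exists m1 m2 x1 x2 (G := fun m => P `&` plane m (dot m v)),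
    [/\ supports S m1 (dot m1 v) /\ supports S m2 (dot m2 v),
        (exists a b, m1 = a *: u + b *: w) /\ (exists a b, m2 = a *: u + b *: w),
        [/\ x1 \in S, dot u x1 < c & G m1 x1] /\ [/\ x2 \in S, dot u x2 < c & G m2 x2],
        G m1 <> G m2
      & forall a b e x F, supports S (a *: u + b *: w) e ->
          F = P `&` plane (a *: u + b *: w) e -> F v ->
          x \in S -> dot u x < c -> F x -> F = G m1 \/ F = G m2].
Proof.
move=> sup vS vc wv x0S x0c ND.
have ind k t : k != 0 -> k *: w + t *: u != 0.
  move=> k0; apply/negP => /eqP h; have [|_ k0'] := ND t k 0.
    by move=> s _; rewrite addrC h dot0l.
  by rewrite k0' eqxx in k0.
(* The largest slope of [w] against [u] gives the first face; applied to [- w] below, the same tilt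
   finds the smallest. *)
have [t1 [x1 [x1S x1c sup1 x1v]]] :
    exists t x, [/\ x \in S, dot u x < c,
      supports S (w + t *: u) (dot (w + t *: u) v)
      & dot (w + t *: u) x = dot (w + t *: u) v].
  apply: supports_extend x0S x0c _ => // t.
  by rewrite -[w]scale1r ind // oner_eq0.
have [t2 [x2 [x2S x2c sup2 x2v]]] :
    exists t x, [/\ x \in S, dot u x < c,
      supports S (- w + t *: u) (dot (- w + t *: u) v)
      & dot (- w + t *: u) x = dot (- w + t *: u) v].
  apply: supports_extend x0S x0c _ => //.
    by move=> s sS sc; rewrite !dotNl wv.
  by move=> t; rewrite -[- w]scaleN1r ind // oppr_eq0 oner_eq0.
have hS s : s \in S -> P s by move=> sS; apply: sub_convex_hull.
exists (w + t1 *: u), (- w + t2 *: u), x1, x2 => G.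
split.
- by [].
- split; first by exists t1, 1; rewrite scale1r addrC.
  by exists t2, (-1); rewrite scaleN1r addrC.
- by split; split=> //; split; rewrite /plane //=; apply: hS.
- move=> G12.
  have : G (- w + t2 *: u) x1 by rewrite -G12; split; [apply: hS|].
  case=> _; rewrite /plane /= => x1v2.
  (* Equal faces mean equal extremal slopes. The two functionals are then opposite while both
     support [S] at [v], so the first is constant on [S], against [ND]. *)
  have t12 : t1 + t2 = 0.
    have : (t1 + t2) * (dot u x1 - c) = 0.
      by move: x1v x1v2; rewrite !dotDl !dotZl !dotNl vc; lra.
    by move/eqP; rewrite mulf_eq0 [_ - c == 0]subr_eq0 (lt_eqF x1c) orbF => /eqP.
  have [|_] := ND t1 1 (dot (w + t1 *: u) v); last by move/eqP; rewrite oner_eq0.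
  move=> s sS; rewrite scale1r addrC; apply/eqP; rewrite eq_le.
  case: sup1 sup2 => _ -> // _ [_ le2 _]; have := le2 s sS.
  have -> : t2 = - t1 by lra.
  by rewrite !dotDl !dotZl !dotNl /=; lra.
- move=> a b e x F [m0 mle _] FE Fv xS xc Fx.
  have ve : e = dot (a *: u + b *: w) v by move: Fv; rewrite FE => -[].
  have xe : dot (a *: u + b *: w) x = e by move: Fx; rewrite FE => -[].
  (* Up to a positive factor the functional is [w] or [- w] plus a multiple of [u], and the sign of
     [b] picks the extremal face. If [b = 0], it is a multiple of [u], which separates [x] from
     [v]. *)
  case: (ltrgtP b 0) => b0.
  + right; have bn : - b > 0 by rewrite oppr_gt0.
    suff at2 : a = - b * t2.
      have -> : - w + t2 *: u = (- b)^-1 *: (a *: u + b *: w).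
        rewrite scalerDr !scalerA at2 mulrA mulVf ?gt_eqF // mul1r addrC.
        by rewrite invrN mulNr mulVf ?lt_eqF // scaleN1r.
      apply: (supports_scale FE) => //.
      by rewrite invr_eq0 gt_eqF.
    (* Two tests at contact points pin [a]: the extremal functional at [x], then the given one at
       [x2]. *)
    apply/eqP; rewrite eq_le; apply/andP; split.
      have : 0 <= (- b * t2 - a) * (c - dot u x).
        case: sup2 => _ /(_ x xS); move: xe; rewrite ve !dotDl !dotZl !dotNl vc.
        nra.
      by rewrite pmulr_lge0 ?subr_gt0 // subr_ge0.
    have : 0 <= (a + b * t2) * (c - dot u x2).
      have := mle x2 x2S; move: x2v; rewrite ve !dotDl !dotZl !dotNl vc.
      nra.
    by rewrite pmulr_lge0 ?subr_gt0 // mulNr; lra.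
  + left.
    suff at1 : a = b * t1.
      have -> : w + t1 *: u = b^-1 *: (a *: u + b *: w).
        by rewrite scalerDr !scalerA at1 mulKf ?gt_eqF // mulVf ?gt_eqF // scale1r addrC.
      apply: (supports_scale FE) => //.
      by rewrite invr_eq0 gt_eqF.
    apply/eqP; rewrite eq_le; apply/andP; split.
      have : 0 <= (b * t1 - a) * (c - dot u x).
        case: sup1 => _ /(_ x xS); move: xe; rewrite ve !dotDl !dotZl vc.
        nra.
      by rewrite pmulr_lge0 ?subr_gt0 // subr_ge0.
    have : 0 <= (a - b * t1) * (c - dot u x1).
      have := mle x1 x1S; move: x1v; rewrite ve !dotDl !dotZl vc.
      nra.
    by rewrite pmulr_lge0 ?subr_gt0 // subr_ge0.
  + have : a * (dot u x - c) = 0.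
      by move: xe; rewrite ve b0 !dotDl !dotZl vc; lra.
    move/eqP; rewrite mulf_eq0 [_ - c == 0]subr_eq0 (lt_eqF xc) orbF => /eqP a0.
    by move: m0; rewrite a0 b0 !scale0r addr0 eqxx.
Qed.

End Any.
End Pencil.

(** * Edges and facets in dimension three *)

Section Dim3.
Context {R : realType}.
Local Notation V := 'rV[R]_3.
Implicit Types (F G P E : set V) (S : seq V) (s u v w x y z d m : V) (a b c t : R).

Lemma convex_hull_vspace (A : set V) x (W : {vspace V}) y :
  (forall s, A s -> s - x \in W) -> convex_hull A y -> y - x \in W.
Proof.
move=> AW [k [p [t [Ap _ t1 ->]]]]; apply: (affine_hull_sub AW).
by exists k, p, t.
Qed.

Lemma has_dim_uniq (A : set V) x k l : A x -> has_dim A k -> has_dim A l -> k = l.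
Proof.
move=> Ax /has_dim_elim /(_ Ax)[U [<- AU Umin]].
move=> /has_dim_elim /(_ Ax)[U' [<- AU' Umin']].
by apply/eqP; rewrite eqn_leq !dimvS ?Umin ?Umin'.
Qed.

Lemma face_pt S F : face (convex_hull [set` S]) F -> exists2 s, s \in S & F s.
Proof.
move=> /face_hull[u [a [[_ _ [s sS sa]] ->]]]; exists s => //.
by split=> //; apply: sub_convex_hull.
Qed.

Definition noncollinear x y z := cross (y - x) (z - x) != 0.

(** Here [n.-1] is 2. Collinear generators have differences spanning at most a line; three
    noncollinear ones give two independent directions, and the normal of [F] forbids a third. *)
Lemma facetP S F : face (convex_hull [set` S]) F ->
  facets (convex_hull [set` S]) F <->
  exists x y z, [/\ x \in S, y \in S & z \in S] /\ [/\ F x, F y, F z & noncollinear x y z].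
Proof.
move=> hF; split=> [[_ dF]|].
  apply: contrapT => hno.
  have [x xS Fx] := face_pt hF.
  have [U [dU FU Umin]] := has_dim_elim dF Fx.
  suff [W dW FW] : exists2 W : {vspace V}, (\dim W <= 1)%N & forall s, s \in S -> F s ->
    s - x \in W.
    have : (\dim U <= 1)%N.
      apply: leq_trans (dimvS _) dW; apply: Umin => y.
      rewrite {1}(face_pts hF); apply: convex_hull_vspace => s /=.
      by rewrite mem_filter => /andP[/asboolP Fs sS]; apply: FW.
    by rewrite dU.
  have [[y [yS Fy yx]]|hy] := pselect (exists y, [/\ y \in S, F y & y != x]).
    exists <[y - x]>%VS; first by rewrite dim_vline leq_b1.
    move=> s sS Fs; apply/vlineP.
    exists (dot (y - x) (s - x) / dot (y - x) (y - x)).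
    apply: cross_eq0; first by rewrite subr_eq0.
    apply: contrapT => /eqP ncol; apply: hno; exists x, y, s; by [].
  exists 0%VS; first by rewrite dimv0.
  move=> s sS Fs; suff -> : s = x by rewrite subrr mem0v.
  by apply: contrapT => /eqP sx; apply: hy; exists s.
move=> [x [y [z [[xS yS zS] [Fx Fy Fz ncol]]]]]; split=> //.
have [u [a [[u0 _ _] FE]]] := (face_hull _ _).1 hF.
have perp w : F w -> dot u (w - x) = 0.
  by move: Fx; rewrite FE => -[_ xa] [_ wa]; rewrite dotBr wa xa subrr.
apply: (@has_dim_intro _ _ _ x [:: y - x; z - x]) => //.
- rewrite free_cons span_seq1 seq1_free; apply/andP; split.
    apply/negP => /vlineP[k yE]; move/negP: ncol; apply.
    by rewrite yE; apply/eqP/row3P; rewrite !crossE !mxE; ring.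
  apply: contra_neq ncol => ->; apply: row3P; rewrite !crossE !mxE; ring.
- by move=> d; rewrite !inE => /orP[] /eqP ->; rewrite addrC subrK.
- move=> w Fw; have [//|//|//|k [l ->]] := plane_cross ncol u0 (x := w - x).
  + exact: perp.
  + exact: perp.
  + exact: perp.
  by rewrite rpredD // rpredZ // memv_span // !inE eqxx ?orbT.
Qed.

Lemma supports_normal S u a v m b e : supports S u a -> m = b *: u -> m != 0 ->
  supports S m e -> v \in S -> dot u v = a -> dot m v = e -> full_dim (convex_hull [set` S]) ->
  convex_hull [set` S] `&` plane m e = convex_hull [set` S] `&` plane u a.
Proof.
move=> [u0 ule _] mE m0 [_ mle _] vS va ve full.
have b0 : b != 0 by apply: contra_neq m0 => b0; rewrite mE b0 scale0r.
apply/seteqP; split=> x [Px]; rewrite /plane /= mE => xa; split=> //; rewrite /plane /=.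
  by apply: (mulfI b0); rewrite -dotZl xa -ve mE dotZl va.
by rewrite dotZl xa -ve mE dotZl va.
Qed.

(** The three points fix the normal up to a scalar of either sign, and a common point then fixes the
    level. *)
Lemma facets_eq S F G x y z (P := convex_hull [set` S]) : full_dim P ->
  face P F -> face P G -> x \in S ->
  [/\ F x, F y & F z] -> [/\ G x, G y & G z] -> noncollinear x y z -> F = G.
Proof.
move=> full /face_hull[u [a [us FE]]] /face_hull[m [b [ms GE]]] xS.
rewrite FE GE => -[[_ xa] [_ ya] [_ za]] [[_ xb] [_ yb] [_ zb]] ncol.
have [||k uE] := perp_cross (m := u) ncol.
- by rewrite dotBr ya xa subrr.
- by rewrite dotBr za xa subrr.
have [||l mE] := perp_cross (m := m) ncol.
- by rewrite dotBr yb xb subrr.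
- by rewrite dotBr zb xb subrr.
have m0 : m != 0 by case: ms.
have l0 : l != 0 by apply: contra_neq m0 => l0; rewrite mE l0 scale0r.
apply: (@supports_normal _ _ _ x u (k / l)) => //.
- by rewrite mE scalerA divfK.
- by case: us.
Qed.

Lemma face_neq_pt S F v : face (convex_hull [set` S]) F -> F v -> F <> [set v] ->
  exists x, [/\ x \in S, F x & x != v].
Proof.
move=> hF Fv Fn; apply: contrapT => hno; apply: Fn; apply/seteqP; split=> [y|_ -> //].
rewrite {1}(face_pts hF); have -> : [set v] = convex_hull [set v] by rewrite convex_hull1.
apply: convex_hull_mono => s /=; rewrite mem_filter => /andP[/asboolP Fs sS].
by apply: contrapT => /eqP sv; apply: hno; exists s.
Qed.

(** Without three noncollinear generators the face spans at most a line, and two distinct points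
    exclude dimension 0. *)
Lemma edge_of_face S E x y (P := convex_hull [set` S]) : face P E ->
  E x -> E y -> x <> y -> ~ facets P E -> edges P E.
Proof.
move=> hE Ex Ey xy nfac; split=> //.
have [p pS Ep] := face_pt hE.
have [q [qS Eq qp]] : exists q, [/\ q \in S, E q & q != p].
  by apply: (face_neq_pt hE Ep) => Es; apply: xy; move: Ex Ey; rewrite Es => -> ->.
have col s : s \in S -> E s -> cross (q - p) (s - p) = 0.
  move=> sS Es; apply: contrapT => /eqP ncol; apply: nfac; apply/facetP => //.
  by exists p, q, s.
apply: (@has_dim_intro _ _ _ p [:: q - p]) => //.
- by rewrite seq1_free subr_eq0.
- by move=> d; rewrite inE => /eqP ->; rewrite addrC subrK.
- move=> s; rewrite span_seq1 {1}(face_pts hE); apply: convex_hull_vspace => z /=.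
  rewrite mem_filter => /andP[/asboolP Ez zS]; apply/vlineP.
  exists (dot (q - p) (z - p) / dot (q - p) (q - p)).
  by apply: cross_eq0; rewrite ?subr_eq0 ?col.
Qed.

Lemma edge_not_facet P E : edges P E -> ~ facets P E.
Proof.
move=> [[u [a [[_ _ [x Px xa]] EE]]] d1] [_ d2].
have Ex : E x by rewrite EE.
by have := has_dim_uniq Ex d1 d2.
Qed.

Lemma face_set1_vertex S F v : face (convex_hull [set` S]) F ->
  F v -> {in S, forall s, F s -> s = v} -> vertices (convex_hull [set` S]) v.
Proof.
move=> hF Fv hv; rewrite /vertices /=; suff <- : F = [set v] by [].
apply: contrapT => /(face_neq_pt hF Fv)[x [xS Fx]].
by rewrite (hv x xS Fx) eqxx.
Qed.

Lemma vertex_extreme S v (a b : V) : vertices (convex_hull [set` S]) v ->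
  a \in S -> b \in S -> convex_hull [set a; b] v -> v = a \/ v = b.
Proof.
move=> /vertexP[w [_ vS lt]] aS bS /convex_hull2P[t [/andP[t0 t1] vE]].
have [->|va] := eqVneq v a; first by left.
have [->|vb] := eqVneq v b; first by right.
have ha := lt a aS; have hb := lt b bS.
have := ha; rewrite eq_sym => /(_ va) {}ha; have := hb; rewrite eq_sym => /(_ vb) {}hb.
have : dot w v = dot w a + t * (dot w b - dot w a) by rewrite {1}vE dotDr dotZr dotBr.
move: ha hb; rewrite !dotBr => ha hb wvE; exfalso.
have h1 : 0 <= (1 - t) * (dot w a - dot w v) by apply: mulr_ge0; lra.
move: t0; rewrite le_eqVlt => /orP[/eqP t0|t0]; first by move: wvE; rewrite -t0; lra.
have : 0 < t * (dot w b - dot w v) by rewrite mulr_gt0.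
lra.
Qed.

(** The generators in [E] lie on a line of direction [d], so [dot d] orders them injectively; the
    least and the greatest are the ends. *)
Lemma edge_ends S E (P := convex_hull [set` S]) : edges P E ->
  exists a b : V, [/\ a <> b, vertices P a, vertices P b, E = convex_hull [set a; b]
    & forall v, vertices P v -> E v -> v = a \/ v = b].
Proof.
move=> [hE d1].
have [p pS Ep] := face_pt hE.
have [q [qS Eq qp]] : exists q, [/\ q \in S, E q & q != p].
  apply: (face_neq_pt hE Ep) => Es.
  have [U [dU _ /(_ 0%VS)]] := has_dim_elim d1 Ep.
  have h0 x : E x -> x - p \in 0%VS by rewrite Es => ->; rewrite subrr mem0v.
  by move=> /(_ h0) /dimvS; rewrite dU dimv0.
set d := q - p; have d0 : d != 0 by rewrite subr_eq0.
have line s : s \in S -> E s -> s = p + (dot d (s - p) / dot d d) *: d.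
  move=> sS Es; rewrite -[LHS](subrK p) addrC; congr (_ + _); apply: cross_eq0 => //.
  apply: contrapT => /eqP ncol; apply: (@edge_not_facet P E) => //.
  by apply/facetP => //; exists p, q, s.
have dinj s s' : s \in S -> s' \in S -> E s -> E s' -> dot d s = dot d s' -> s = s'.
  by move=> sS sS' Es Es' h; rewrite (line s) // (line s') // !dotBr h.
pose T := [seq s <- S | `[< E s >]].
have TP s : s \in T <-> s \in S /\ E s.
  by rewrite mem_filter; split=> [/andP[/asboolP]|[-> h]]; [|rewrite andbT; apply/asboolP].
have pT : p \in T by apply/TP.
have [a /TP[aS Ea] amin] := seq_argmax (fun s => - dot d s) pT.
have [b /TP[bS Eb] bmax] := seq_argmax (dot d) pT.
have bmax' s : s \in S -> E s -> dot d s <= dot d b by move=> sS Es; apply/bmax/TP.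
have amin' s : s \in S -> E s -> dot d a <= dot d s.
  by move=> sS Es; rewrite -lerN2; apply/amin/TP.
(* An end is the face of [E] cut out by [d] or [- d], and faces of [E] are faces of [P]. The scalar
   [k] covers both ends: it is -1 for [a] and 1 for [b]. *)
have extreme e k : k != 0 -> e \in S -> E e -> (forall s, s \in S -> E s ->
  k * dot d s <= k * dot d e) ->
    vertices P e.
  move=> k0 eS Ee hk.
  have sup : supports T (k *: d) (k * dot d e).
    split; rewrite ?scaler_eq0 ?negb_or ?k0 //.
      by move=> s /TP[sS Es]; rewrite dotZl hk.
    by exists e; rewrite ?dotZl //; apply/TP.
  have hG : face E (E `&` plane (k *: d) (k * dot d e)).
    have := hE; move=> /face_pts EE; rewrite {1 2}EE; apply/face_hull.
    by exists (k *: d), (k * dot d e).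
  apply: (face_set1_vertex (face_trans hE hG)).
    by split=> //; rewrite /plane /= dotZl.
  move=> s sS [Es]; rewrite /plane /= dotZl => /(mulfI k0); exact: dinj.
have dab : dot d a < dot d b.
  rewrite lt_neqAle amin' // andbT; apply/negP => /eqP dab.
  have : dot d p = dot d q.
    have := amin' p pS Ep; have := amin' q qS Eq; have := bmax' p pS Ep; have := bmax' q qS Eq.
    by rewrite dab; lra.
  by move/dinj => /(_ pS qS Ep Eq) pq; rewrite pq eqxx in qp.
have va : vertices P a.
  apply: (extreme a (-1)) => //; first by rewrite oppr_eq0 oner_eq0.
  by move=> s sS Es; rewrite !mulN1r lerN2 amin'.
have vb : vertices P b.
  apply: (extreme b 1) => //; first by rewrite oner_eq0.
  by move=> s sS Es; rewrite !mul1r bmax'.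
have EE : E = convex_hull [set a; b].
  apply/seteqP; split=> [x Ex|x].
    have xd : x - p \in <[d]>%VS.
      move: Ex; rewrite {1}(face_pts hE); apply: convex_hull_vspace => s.
      move=> /TP[sS Es]; rewrite {1}(line s sS Es) addrC addKr.
      by rewrite memvZ // memv_line.
    have xle : dot d x <= dot d b.
      move: Ex; rewrite {1}(face_pts hE); apply: convex_hull_le => s /TP[sS Es].
      exact: bmax'.
    have xge : dot d a <= dot d x.
      rewrite -lerN2 -dotNl; move: Ex; rewrite {1}(face_pts hE);
        apply: convex_hull_le => s /TP[sS Es].
      by rewrite dotNl lerN2 amin'.
    apply/convex_hull2P; exists ((dot d x - dot d a) / (dot d b - dot d a)).
    have hab : 0 < dot d b - dot d a by rewrite subr_gt0.
    split.
      by apply/andP; split; [apply: divr_ge0; lra|rewrite ler_pdivrMr // mul1r; lra].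
    move/vlineP : xd => [k xk].
    have hd := lt0r_neq0 (dot_gt0 d0).
    have xE : x = p + k *: d by rewrite -xk addrC subrK.
    set t := _ / _; have tE : t * (dot d b - dot d a) = dot d x - dot d a.
      by rewrite divfK ?gt_eqF.
    have [k1 aE] : exists k1, a = p + k1 *: d by eexists; apply: line.
    have [k2 bE] : exists k2, b = p + k2 *: d by eexists; apply: line.
    move: t tE => t tE.
    have kE : k - k1 = t * (k2 - k1).
      apply: (mulIf hd); move: tE; rewrite aE bE xE !(dotDr _ p) !dotZr; lra.
    rewrite bE aE xE opprD addrACA subrr add0r -scalerBl scalerA -kE -addrA -scalerDl.
    by congr (_ + _ *: _); lra.
  have [u [c [_ EE]]] := (face_hull _ _).1 hE.
  move: (Ea) (Eb); rewrite EE => -[_ ac] [_ bc] hx; split.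
    by apply: convex_hull_mono hx => _ [] ->.
  by move: hx => /convex_hull2P[t [_ ->]];
    rewrite /plane /= dotDr dotZr dotBr ac bc subrr mulr0 addr0.
exists a, b; split=> //; first by move=> ab; move: dab; rewrite ab ltxx.
by move=> v vv; rewrite EE; apply: (vertex_extreme vv).
Qed.

End Dim3.

(** * Incidences between vertices, edges and facets *)

Section Incidence.
Context {R : realType}.
Local Notation V := 'rV[R]_3.
Implicit Types (F G P E : set V) (S : seq V) (s u v w x y z d m p q : V) (a b c e t k : R).

Lemma cross_neq0 u : u != 0 -> exists d, cross d u != 0.
Proof.
move=> u0; apply: contrapT => /forallNP h.
have c0 d : cross d u = 0 by apply/eqP; have := h d; case: (cross d u == 0).
move/negP: u0; apply; apply/eqP/row3P; rewrite mxE.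
- have := congr1 (fun x : V => x 0 2) (c0 (delta_mx 0 1)).
  by rewrite !crossE !mxE /=; lra.
- have := congr1 (fun x : V => x 0 2) (c0 (delta_mx 0 0)).
  by rewrite !crossE !mxE /=; lra.
- have := congr1 (fun x : V => x 0 1) (c0 (delta_mx 0 0)).
  by rewrite !crossE !mxE /=; lra.
Qed.

Lemma noncollinear_dot u x y z : dot u x = dot u y -> x <> y -> dot u z <> dot u x ->
  noncollinear x y z.
Proof.
move=> uxy xy uzx; apply/negP => /eqP /cross_eq0 h.
apply: uzx; apply/eqP; rewrite -subr_eq0 -dotBr h ?dotZr ?dotBr ?uxy ?subrr ?mulr0 //.
by rewrite subr_eq0; apply/eqP => yx; apply: xy.
Qed.

Lemma full_supports_lt S u c : full_dim (convex_hull [set` S]) -> supports S u c ->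
  exists2 x, x \in S & dot u x < c.
Proof.
move=> full [u0 le _]; apply: contrapT => h; move/negP: u0; apply; apply/eqP.
apply: (full_dim_pts full (a := c)) => s sS; apply/eqP; rewrite eq_le le //=.
by rewrite leNgt; apply/negP => sc; apply: h; exists s.
Qed.

Lemma pencil_free d u a b : cross d u != 0 -> a *: u + b *: cross d u = 0 -> a = 0 /\ b = 0.
Proof.
move=> n0 h; have u0 : u != 0.
  by apply: contra_neq n0 => ->; apply: row3P; rewrite !crossE !mxE; ring.
have ha : a = 0.
  have := congr1 (dot u) h; rewrite dotDr !dotZr dot_crossr mulr0 addr0 dot0r.
  by move/eqP; rewrite mulf_eq0 dot_eq0 (negbTE u0) orbF => /eqP.
split=> //; move/eqP: h; rewrite ha scale0r add0r scaler_eq0 (negbTE n0) orbF.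
by move/eqP.
Qed.

Lemma vertex_mem S v : vertices (convex_hull [set` S]) v -> v \in S.
Proof. by move=> /vertexP[w []]. Qed.

Lemma edge_mem S E v : edges (convex_hull [set` S]) E -> E v ->
  exists x, [/\ x \in S, E x & x != v].
Proof.
move=> hE Ev; have [a [b [ab va vb EE _]]] := edge_ends hE.
have Ea : E a by rewrite EE; apply: sub_convex_hull; left.
have Eb : E b by rewrite EE; apply: sub_convex_hull; right.
have [av|av] := eqVneq a v.
  by exists b; rewrite (vertex_mem vb) -av; split=> //; apply/eqP => ba; apply: ab.
by exists a; rewrite (vertex_mem va).
Qed.

(** The pencil, spanned by [u] and [cross d u], consists of the functionals constant along the edge.
    Its two extremal faces contain the edge and a point off it, so they are facets; conversely the
    normal of any facet through the edge is orthogonal to [d]. *)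
Lemma edge_two_facets S E (P := convex_hull [set` S]) : full_dim P -> edges P E ->
  exists F1 F2, [/\ F1 <> F2, facets P F1 /\ E `<=` F1, facets P F2 /\ E `<=` F2
    & forall F, facets P F -> E `<=` F -> F = F1 \/ F = F2].
Proof.
move=> full edge; have [hE _] := edge.
have [a [b [ab va vb Eab _]]] := edge_ends edge.
have aS := vertex_mem va; have bS := vertex_mem vb.
have Ea : E a by rewrite Eab; apply: sub_convex_hull; left.
have Eb : E b by rewrite Eab; apply: sub_convex_hull; right.
have [u [c [sup EE]]] := (face_hull _ _).1 hE; have [u0 ule _] := sup.
have ac : dot u a = c by move: Ea; rewrite EE => -[].
have bc : dot u b = c by move: Eb; rewrite EE => -[].
set d := b - a; have d0 : d != 0 by rewrite subr_eq0; apply/eqP => ba; apply: ab.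
have ud : dot u d = 0 by rewrite dotBr ac bc subrr.
have n0 : cross d u != 0 by apply: contra_neq u0; apply: cross_perp_eq0.
have [x0 x0S x0c] := full_supports_lt full sup.
have const m x : dot m d = 0 -> E x -> dot m x = dot m a.
  by move=> md; rewrite Eab => /convex_hull2P[t [_ ->]]; rewrite dotDr dotZr md mulr0 addr0.
have ES s : s \in S -> dot u s = c -> E s.
  by move=> sS sc; rewrite EE; split=> //; apply: sub_convex_hull.
have wconst : {in S, forall s, dot u s = c -> dot (cross d u) s = dot (cross d u) a}.
  by move=> s sS /(ES s sS); apply: const; rewrite dotC dot_crossl.
have ND k l e : {in S, forall s, dot (k *: u + l *: cross d u) s = e} -> k = 0 /\ l = 0.
  by move=> h; apply: (@pencil_free d u) => //; apply: (full_dim_pts full h).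
have [m1 [m2 [x1 [x2 h]]]] := pencil_two sup aS ac wconst x0S x0c ND.
move: h; set G := fun m => _.
move=> [[sup1 sup2] [[k1 [l1 m1E]] [k2 [l2 m2E]]] [[x1S x1c Gx1] [x2S x2c Gx2]] G12 uniq].
have facet m k l x : supports S m (dot m a) -> m = k *: u + l *: cross d u ->
    x \in S -> dot u x < c -> G m x -> facets P (G m) /\ E `<=` G m.
  move=> supm mE xS xc Gx.
  have md : dot m d = 0.
    by rewrite mE dotDl !dotZl ud (dotC (cross _ _)) dot_crossl !mulr0 addr0.
  have EG : E `<=` G m.
    move=> y Ey; split; first by move: Ey; rewrite EE => -[].
    exact: const.
  split=> //; apply/facetP; first by apply/face_hull; exists m, (dot m a).
  exists a, b, x; split=> //; split=> //; try exact: EG.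
  by apply: (@noncollinear_dot u); rewrite ?ac ?bc // => xc'; rewrite xc' ltxx in xc.
exists (G m1), (G m2); split=> //;
  [exact: facet sup1 m1E x1S x1c Gx1|exact: facet sup2 m2E x2S x2c Gx2|].
move=> F [hF dF] EF; have [m [e [supm FE]]] := (face_hull _ _).1 hF.
have md : dot m d = 0.
  by rewrite dotBr; have := EF _ Ea; have := EF _ Eb; rewrite FE => -[_ ->] [_ ->];
    rewrite subrr.
have [k [l mE]] := pencil_perp d0 u0 ud md.
have [x [xS Fx xc]] : exists x, [/\ x \in S, F x & dot u x < c].
  apply: contrapT => h; apply: (@edge_not_facet _ P E edge); suff <- : F = E by [].
  apply: face_ext hF hE _ => s sS; split=> [Fs|/EF //].
  apply: ES => //; apply/eqP; rewrite eq_le ule //= leNgt; apply/negP => sc.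
  by apply: h; exists s.
rewrite mE in supm FE.
exact: uniq supm FE (EF _ Ea) xS xc Fx.
Qed.

(** Tilting the plane of a one-point face adds a contact point and gives an edge or a facet; an edge
    lies in a facet by the pencil around it. *)
Lemma face_sub_facet S F (P := convex_hull [set` S]) : full_dim P -> face P F ->
  exists2 G, facets P G & F `<=` G.
Proof.
move=> full hF; have [facF|nfac] := pselect (facets P F); first by exists F.
have edge_case E : edges P E -> exists2 G, facets P G & E `<=` G.
  by move=> /(edge_two_facets full)[G [_ [_ [facG EG] _ _]]]; exists G.
have [v vS Fv] := face_pt hF.
have [Fs|/(face_neq_pt hF Fv)[x [xS Fx xv]]] := pselect (F = [set v]); last first.
  by apply: edge_case; apply: edge_of_face hF Fx Fv _ nfac => xv'; rewrite xv' eqxx in xv.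
have [u [c [sup FE]]] := (face_hull _ _).1 hF; have [u0 ule _] := sup.
have vc : dot u v = c by move: Fv; rewrite FE => -[].
have [x0 x0S x0c] := full_supports_lt full sup.
have [d n0] := cross_neq0 u0.
have [||t [x [xS xc sup' xv]]] := supports_extend sup vS vc (w := cross d u) _ x0S x0c.
- move=> s sS sc; suff -> : s = v by [].
  suff : F s by rewrite Fs.
  by rewrite FE; split=> //; apply: sub_convex_hull.
- move=> t; apply/negP => /eqP h.
  have [|_] := @pencil_free d u t 1 n0; first by rewrite scale1r addrC.
  by move/eqP; rewrite oner_eq0.
set m := _ + _ in sup' xv; set G := P `&` plane m (dot m v).
have hG : face P G by apply/face_hull; exists m, (dot m v).
have Gv : G v by split=> //; apply: sub_convex_hull.
have Gx : G x by split=> //; apply: sub_convex_hull.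
have FG : F `<=` G by rewrite Fs => _ ->.
have [facG|nfacG] := pselect (facets P G); first by exists G.
have [|H facH GH] := edge_case G.
  by apply: edge_of_face hG Gx Gv _ nfacG => xv'; rewrite xv' vc ltxx in xc.
by exists H => // y /FG /GH.
Qed.

(** The pencil argument inside the plane of [F]: with [n] its normal, functionals on that plane are
    represented by vectors orthogonal to [n], and the pencil is spanned by [u], which touches [F] at
    [v] only, and [cross n u]. *)
Lemma facet_vertex_two_edges S F v (P := convex_hull [set` S]) : full_dim P ->
  facets P F -> vertices P v -> F v ->
  exists E1 E2, [/\ E1 <> E2, [/\ edges P E1, E1 v & E1 `<=` F],
      [/\ edges P E2, E2 v & E2 `<=` F]
    & forall E, edges P E -> E v -> E `<=` F -> E = E1 \/ E = E2].
Proof.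
move=> full facF vv Fv; have [hF _] := facF.
have [n [c0 [supn FE]]] := (face_hull _ _).1 hF; have [n0 nle _] := supn.
pose T := [seq s <- S | `[< F s >]]; have FT : F = convex_hull [set` T] := face_pts hF.
have TP s : s \in T <-> s \in S /\ F s.
  by rewrite mem_filter; split=> [/andP[/asboolP]|[-> h]]; [|rewrite andbT; apply/asboolP].
have [w [_ vS wlt]] := (vertexP _ _).1 vv.
have vT : v \in T by apply/TP.
have nF x : F x -> dot n x = c0 by rewrite FE => -[].
have nT x : x \in T -> dot n x = c0 by move=> /TP[_ /nF].
(* The projection of [- w] orthogonal to [n]. The added multiple of [n] is constant on [F], so [v]
   is the strict maximiser among the generators in [F]. *)
pose u := (dot w n / dot n n) *: n - w.
have un : dot u n = 0.
  by rewrite dotBl dotZl divfK ?subrr // lt0r_neq0 // dot_gt0.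
have uT s : s \in T -> s != v -> dot u s < dot u v.
  move=> /TP[sS Fs] sv; have := wlt s sS sv; rewrite dotBr !dotBl !dotZl (nF s) // (nF v) //.
  lra.
have [x [y [z [[xS yS zS] [Fx Fy Fz ncol]]]]] :
  exists x y z, [/\ x \in S, y \in S & z \in S] /\ [/\ F x, F y, F z & noncollinear x y z].
  exact/facetP.
have [x0 x0T x0v] : exists2 x0, x0 \in T & x0 != v.
  have [xv|xv] := eqVneq x v; last by exists x => //; apply/TP.
  exists y; first exact/TP.
  apply: contraNneq ncol => yv; rewrite xv yv subrr.
  by apply/eqP/row3P; rewrite !crossE !mxE; ring.
have x0c := uT x0 x0T x0v.
have u0 : u != 0 by apply: contraTneq x0c => ->; rewrite !dot0l ltxx.
have sup : supports T u (dot u v).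
  split=> //; last by exists v.
  by move=> s sT; have [->//|/(uT s sT)/ltW] := eqVneq s v.
have cr0 : cross n u != 0 by apply: contra_neq u0; apply: cross_perp_eq0.
(* A functional constant on three noncollinear points of [F] is a multiple of [n]; being also
   orthogonal to [n], it vanishes. *)
have ND a b e : {in T, forall s, dot (a *: u + b *: cross n u) s = e} -> a = 0 /\ b = 0.
  move=> h; apply: (@pencil_free n u) => //; set m := _ + _ in h *.
  have mn : dot m n = 0.
    by rewrite dotDl !dotZl un (dotC (cross _ _)) dot_crossl !mulr0 addr0.
  have xT : x \in T by apply/TP. have yT : y \in T by apply/TP. have zT : z \in T by apply/TP.
  have [||k mE] := perp_cross (m := m) ncol; rewrite ?dotBr ?h ?subrr //.
  have [||l nE] := perp_cross (m := n) ncol; rewrite ?dotBr ?nT ?subrr //.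
  move: mn; rewrite {1}nE dotZr => /eqP; rewrite mulf_eq0 => /orP[/eqP l0|].
    by move: n0; rewrite nE l0 scale0r eqxx.
  rewrite mE dotZl mulf_eq0 dot_eq0 (negbTE ncol) orbF => /eqP ->.
  by rewrite scale0r.
have wconst : {in T, forall s, dot u s = dot u v -> dot (cross n u) s = dot (cross n u) v}.
  by move=> s sT sv; have [->//|/(uT s sT)] := eqVneq s v; rewrite sv ltxx.
have [m1 [m2 [x1 [x2 h]]]] := pencil_two sup vT erefl wconst x0T x0c ND.
move: h; set G := fun m => _.
move=> [[sup1 sup2] [[k1 [l1 m1E]] [k2 [l2 m2E]]] [[x1T x1c Gx1] [x2T x2c Gx2]] G12 uniq].
have edgeG m k l p : supports T m (dot m v) -> m = k *: u + l *: cross n u ->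
    dot u p < dot u v -> G m p -> [/\ edges P (G m), G m v & G m `<=` F].
  move=> supm mE pc Gp.
  have Gv : G m v by split=> //; apply: sub_convex_hull.
  have GF : G m `<=` F by move=> q [Pq _]; rewrite FT.
  have hG : face P (G m).
    by apply: face_trans hF _; rewrite FT; apply/face_hull; exists m, (dot m v).
  split=> //; apply: (edge_of_face hG Gp Gv) => [pv|facG].
    by rewrite pv ltxx in pc.
  (* Were the extremal face two-dimensional, it would be all of [F] and its functional constant on
     [T], against [ND]. *)
  have [p1 [p2 [p3 [[p1S p2S p3S] [G1 G2 G3 ncol']]]]] := (facetP hG).1 facG.
  have FG : F = G m.
    by apply: (facets_eq full hF hG p1S _ _ ncol'); split=> //; apply: GF.
  have [k0 l0] : k = 0 /\ l = 0.
    apply: (ND k l (dot m v)) => s /TP[_]; rewrite FG -mE.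
    by case.
  by case: supm; rewrite mE k0 l0 !scale0r addr0 eqxx.
exists (G m1), (G m2); split=> //;
  [exact: edgeG sup1 m1E x1c Gx1|exact: edgeG sup2 m2E x2c Gx2|].
move=> E edge Ev EF.
have [p [pS Ep pv]] := edge_mem edge Ev.
have pT : p \in T by apply/TP; split=> //; apply: EF.
have := face_restrict edge.1 (face_sub hF) EF.
rewrite {1}FT => /face_hull[m [e [supm EE]]].
(* The functional cutting [E] from [F] is projected orthogonally to [n]: this shifts it on [F] by
   the constant [k * c0] and puts it in the pencil. *)
set k := dot m n / dot n n.
have m'n : dot (m - k *: n) n = 0.
  by rewrite dotBl dotZl divfK ?subrr // lt0r_neq0 // dot_gt0.
have EE' : E = convex_hull [set` T] `&` plane (m - k *: n) (e - k * c0).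
  rewrite EE; apply/seteqP; split=> q [Pq]; rewrite /plane /= => qe; split=> //.
    by rewrite /plane /= dotBl dotZl qe nF // FT.
  rewrite /plane /=; move: qe; rewrite dotBl dotZl nF ?FT //; lra.
have [a [b m'E]] := pencil_perp n0 u0 un m'n.
rewrite m'E in EE'.
suff supm' : supports T (m - k *: n) (e - k * c0).
  by rewrite m'E in supm'; apply: uniq supm' EE' Ev pT (uT p pT pv) Ep.
have [m0 mle [q qT qe]] := supm; split.
(* A vanishing projection would make [E] all of [F], at once an edge and a facet. *)
- rewrite m'E; apply/negP => /eqP h; apply: (@edge_not_facet _ P E edge); suff <- : F = E by [].
  rewrite EE' h FT; apply/seteqP; split=> r; last by case.
  move=> Pr; split=> //; rewrite /plane /= dot0l; apply/esym.
  by move: Ev; rewrite EE' h => -[_]; rewrite /plane /= dot0l.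
- by move=> s sT; rewrite dotBl dotZl nT // lerD2r mle.
- by exists q => //; rewrite dotBl dotZl nT // qe.
Qed.

Lemma edges_facet S F (P := convex_hull [set` S]) : facets P F ->
  edges F = [set E | edges P E /\ E `<=` F].
Proof.
move=> [hF _]; apply/seteqP; split=> [E [hE dE]|E [[hE dE] EF]].
  by split; [split=> //; apply: face_trans hF hE|apply: face_sub hE].
by split=> //; apply: face_restrict hE (face_sub hF) EF.
Qed.

(** The common face has two points; three noncollinear ones would make the facets equal. *)
Lemma facets_inter_edge S F G x y (P := convex_hull [set` S]) : full_dim P ->
  facets P F -> facets P G -> F <> G -> F x -> F y -> G x -> G y -> x <> y ->
  edges P (F `&` G).
Proof.
move=> full [hF dF] [hG dG] FG Fx Fy Gx Gy xy.
have hFG := face_inter full hF hG Fx Gx.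
apply: (edge_of_face hFG _ _ xy) => //.
move=> /(facetP hFG)[p [q [r [[pS _ _] [[Fp Gp] [Fq Gq] [Fr Gr] ncol]]]]].
apply: FG; exact: (facets_eq full hF hG pS _ _ ncol).
Qed.

Lemma edge_vertices S E x y (P := convex_hull [set` S]) : edges P E ->
  vertices P x -> vertices P y -> E x -> E y -> x <> y -> E = convex_hull [set x; y].
Proof.
move=> hE vx vy Ex Ey xy; have [a [b [ab va vb EE h]]] := edge_ends hE.
case: (h x vx Ex) => xE; case: (h y vy Ey) => yE; rewrite xE yE // in xy *.
by rewrite setUC.
Qed.

End Incidence.

(** * Facets lying on both sides of a level plane through a vertex *)

Section Crossing.
Context {R : realType}.
Local Notation V := 'rV[R]_3.
Implicit Types (F G P E : set V) (S : seq V) (s u v w x y z d m p q : V) (a b c e t k : R).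

(** In the polygon [F], the point [v] is neither highest nor lowest with respect to [u]. *)
Definition crosses S u F v := [/\ F v,
  exists p, [/\ p \in S, F p & dot u v < dot u p]
  & exists q, [/\ q \in S, F q & dot u q < dot u v]].

Lemma face_through P m a F v p q : F = P `&` plane m a -> F v -> P p -> P q ->
  dot m (p - v) = 0 -> dot m (q - v) = 0 -> F p /\ F q.
Proof.
move=> -> [_]; rewrite /plane /= => va Pp Pq; rewrite !dotBr va.
by move=> /eqP; rewrite subr_eq0 => /eqP pa /eqP; rewrite subr_eq0 => /eqP qa; split; split.
Qed.

(* The cone at [v] spanned by [S] meets the plane [u = 0] in the cone spanned by
   the vectors [r p q], with [p] above and [q] below [v]; the two extremal rays
   of this planar cone are the traces of the two crossing facets. *)
Lemma vertex_two_crossings S u v (P := convex_hull [set` S]) : full_dim P ->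
  vertices P v -> {in S, forall s, s != v -> dot u s != dot u v} ->
  (exists2 p, p \in S & dot u v < dot u p) -> (exists2 q, q \in S & dot u q < dot u v) ->
  exists F1 F2, [/\ F1 <> F2, facets P F1 /\ crosses S u F1 v, facets P F2 /\ crosses S u F2 v
    & forall F, facets P F -> crosses S u F v -> F = F1 \/ F = F2].
Proof.
move=> full vv uv [p0 p0S p0u] [q0 q0S q0u].
have [w [w0 vS wlt]] := (vertexP _ _).1 vv.
have Sh s : s \in S -> P s by move=> sS; apply: sub_convex_hull.
(* The combination of [p - v] and [q - v] on which [u] vanishes. For [p] above and [q] below, both
   coefficients are positive, so [r p q] lies in the cone at [v]. *)
pose r p q := dot u (p - v) *: (q - v) - dot u (q - v) *: (p - v).
have ur p q : dot u (r p q) = 0 by rewrite /r (dotBr _ (_ *: _)) !dotZr mulrC subrr.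
have dr m p q : dot m (r p q) = dot u (p - v) * dot m (q - v) - dot u (q - v) * dot m (p - v).
  by rewrite /r (dotBr _ (_ *: _)) !dotZr.
have up p : dot u v < dot u p -> 0 < dot u (p - v) by rewrite dotBr subr_gt0.
have dn q : dot u q < dot u v -> dot u (q - v) < 0 by rewrite dotBr subr_lt0.
have nv x : dot u x != dot u v -> x != v by apply: contra_neq => ->.
have wr p q : p \in S -> q \in S -> dot u v < dot u p -> dot u q < dot u v -> 0 < dot w (r p q).
  move=> pS qS pu qu; rewrite dr subr_gt0.
  have hp := wlt p pS (nv p (negbT (gt_eqF pu))).
  have hq := wlt q qS (nv q (negbT (lt_eqF qu))).
  apply: (@lt_trans _ _ 0); first by rewrite nmulr_rlt0 ?dn.
  by rewrite mulr_gt0 ?up.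
pose U := [seq p <- S | dot u v < dot u p]; pose D := [seq q <- S | dot u q < dot u v].
(* The origin stands for [v]: it is the apex of the planar cone, supported there by [- w]. *)
pose S' : seq V := 0 :: [seq r p q | p <- U, q <- D].
have S'P x : x \in S' -> x = 0 \/ exists p q,
    [/\ p \in S, q \in S, dot u v < dot u p, dot u q < dot u v & x = r p q].
  rewrite inE => /orP[/eqP|/allpairsP[[p q] /= [+ + ->]]]; first by left.
  by rewrite !mem_filter => /andP[pu pS] /andP[qu qS]; right; exists p, q.
have S'r p q : p \in S -> q \in S -> dot u v < dot u p -> dot u q < dot u v -> r p q \in S'.
  move=> pS qS pu qu; rewrite inE; apply/orP; right; apply/allpairsP.
  by exists (p, q); rewrite !mem_filter /= pS qS pu qu.
have n0 : cross u w != 0.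
  have uneq : u != 0 by apply: contraTneq p0u => ->; rewrite !dot0l ltxx.
  apply/negP => /eqP /(cross_eq0 uneq) wE; set k := _ / _ in wE.
  have := wr p0 q0 p0S q0S p0u q0u.
  by rewrite wE dotZl ur mulr0 ltxx.
have free a b k : a *: (- w) + b *: cross u w + k *: u = 0 -> a = 0 /\ b = 0.
  move=> h; have hb : b = 0.
    have := congr1 (dot (cross u w)) h.
    rewrite !dotDr !dotZr dotNr (dotC _ w) dot_crossr (dotC _ u) dot_crossl.
    rewrite oppr0 !mulr0 add0r addr0 dot0r => /eqP.
    by rewrite mulf_eq0 dot_eq0 (negbTE n0) orbF => /eqP.
  split=> //; have := congr1 (cross u) h; rewrite hb scale0r addr0.
  have -> : cross u (a *: - w + k *: u) = - a *: cross u w.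
    by apply: row3P; rewrite !(crossE, mxE); ring.
  have -> : cross u 0 = 0 by apply: row3P; rewrite !(crossE, mxE); ring.
  by move/eqP; rewrite scaler_eq0 (negbTE n0) orbF oppr_eq0 => /eqP.
have free0 a b : a *: (- w) + b *: cross u w != 0 ->
  forall k, a *: (- w) + b *: cross u w + k *: u != 0.
  move=> + k; apply: contra_neq => /free[-> ->].
  by rewrite !scale0r addr0.
(* A functional supporting the planar cone along [r p q] extends to one supporting [P] at [v]: the
   free multiple of [u] is chosen to make [p - v] vanish, and the signs at all other generators
   follow from the values on the vectors [r p' q']. *)
have lift m p q : (forall k, m + k *: u != 0) ->
    p \in S -> q \in S -> dot u v < dot u p -> dot u q < dot u v ->
    {in S', forall x, dot m x <= 0} -> dot m (r p q) = 0 ->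
    exists F, [/\ facets P F, crosses S u F v & forall p' q', p' \in S -> q' \in S ->
      dot u v < dot u p' -> dot u q' < dot u v -> dot m (r p' q') = 0 <-> F p' /\ F q'].
  move=> mk pS qS pu qu mle mr.
  have p1 := up p pu; have q1 := dn q qu.
  pose k := - dot m (p - v) / dot u (p - v); set M := m + k *: u.
  have Mr p' q' : dot M (r p' q') = dot m (r p' q') by rewrite dotDl dotZl ur mulr0 addr0.
  have Mp : dot M (p - v) = 0 by rewrite dotDl dotZl divfK ?gt_eqF // subrr.
  have Mle p' q' : p' \in S -> q' \in S -> dot u v < dot u p' -> dot u q' < dot u v ->
      dot M (r p' q') <= 0 by move=> *; rewrite Mr mle // S'r.
  have Mq' q' : q' \in S -> dot u q' < dot u v -> dot M (q' - v) <= 0.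
    move=> q'S q'u; have := Mle p q' pS q'S pu q'u.
    by rewrite dr Mp mulr0 subr0 pmulr_rle0.
  have Mq : dot M (q - v) = 0.
    have := Mr p q; rewrite mr dr Mp mulr0 subr0 => /eqP.
    by rewrite mulf_eq0 gt_eqF //= => /eqP.
  have Mp' p' : p' \in S -> dot u v < dot u p' -> dot M (p' - v) <= 0.
    move=> p'S p'u; have := Mle p' q p'S qS p'u qu.
    by rewrite dr Mq mulr0 sub0r oppr_le0 nmulr_rge0.
  have supM : supports S M (dot M v).
    split; [exact: mk| |by exists v].
    move=> s sS; rewrite -subr_le0 -dotBr.
    have [->|sv] := eqVneq s v; first by rewrite subrr dot0r.
    have := uv s sS sv; rewrite neq_lt => /orP[]; [exact: Mq'|exact: Mp'].
  pose F := P `&` plane M (dot M v).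
  have hF : face P F by apply/face_hull; exists M, (dot M v).
  have Fv : F v by split=> //; apply: Sh.
  have [Fp Fq] : F p /\ F q by apply: (face_through erefl Fv) => //; exact: Sh.
  exists F; split.
  - apply/facetP => //; exists v, p, q; split=> //; split=> //.
    (* If [q - v] were a multiple of [p - v], then [r p q] would be zero, against [wr]. *)
    apply/negP => /eqP /cross_eq0; rewrite subr_eq0 nv ?gt_eqF // => /(_ isT) qE.
    have := wr p q pS qS pu qu; rewrite /r qE; set l := _ / _.
    by rewrite scalerA dotZr mulrC -scalerBl subrr scale0r dot0r ltxx.
  - by split=> //; [exists p|exists q].
  - move=> p' q' p'S q'S p'u q'u; rewrite -Mr; split=> [h|[[_ Fp'] [_ Fq']]].
      have hp := Mp' p' p'S p'u; have hq := Mq' q' q'S q'u.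
      have h1 : dot u (p' - v) * dot M (q' - v) <= 0 by rewrite pmulr_rle0 ?up.
      have h2 : 0 <= dot u (q' - v) * dot M (p' - v) by rewrite nmulr_rge0 ?dn.
      move: h; rewrite dr => h.
      have /eqP : dot u (p' - v) * dot M (q' - v) = 0 by lra.
      rewrite mulf_eq0 gt_eqF ?up //= => /eqP hq'.
      have /eqP : dot u (q' - v) * dot M (p' - v) = 0 by lra.
      rewrite mulf_eq0 lt_eqF ?dn //= => /eqP hp'.
      by apply: (face_through erefl Fv) => //; exact: Sh.
    rewrite dr !dotBr; move: Fp' Fq'; rewrite /plane /= => -> ->.
    by rewrite !subrr !mulr0 subrr.
have zS' : 0 \in S' by rewrite mem_head.
have sup : supports S' (- w) 0.
  split; rewrite ?oppr_eq0 //; last by exists 0; rewrite ?dot0r.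
  move=> x /S'P[->|[p [q [pS qS pu qu ->]]]]; first by rewrite dot0r.
  by rewrite dotNl oppr_le0 ltW // wr.
have wconst : {in S', forall s, dot (- w) s = 0 -> dot (cross u w) s = dot (cross u w) 0}.
  move=> x /S'P[->//|[p [q [pS qS pu qu ->]]]].
  by move/eqP; rewrite dotNl oppr_eq0 gt_eqF // wr.
have x0c : dot (- w) (r p0 q0) < 0 by rewrite dotNl oppr_lt0 wr.
(* A functional constant on [S'] is zero there, since [S'] contains 0. Adding the multiple of [u]
   that makes it vanish at [p0 - v] gives a functional constant on [S], hence zero by full
   dimension. *)
have ND a b e : {in S', forall s, dot (a *: - w + b *: cross u w) s = e} -> a = 0 /\ b = 0.
  move=> h; set m := _ + _ in h; have := h 0 zS'; rewrite dot0r => e0; rewrite -e0 in h.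
  pose k := - dot m (p0 - v) / dot u (p0 - v); apply: (@free a b k); rewrite -/m.
  have mp0 : dot (m + k *: u) (p0 - v) = 0.
    by rewrite dotDl dotZl divfK ?gt_eqF ?up // subrr.
  have mr p q : p \in S -> q \in S -> dot u v < dot u p -> dot u q < dot u v ->
      dot (m + k *: u) (r p q) = 0.
    by move=> pS qS pu qu; rewrite dotDl dotZl ur mulr0 addr0 h // S'r.
  have mq q : q \in S -> dot u q < dot u v -> dot (m + k *: u) (q - v) = 0.
    move=> qS qu; have := mr p0 q p0S qS p0u qu; rewrite dr mp0 mulr0 subr0.
    by move/eqP; rewrite mulf_eq0 gt_eqF ?up //= => /eqP.
  apply: (full_dim_pts full (a := dot (m + k *: u) v)) => s sS.
  apply/eqP; rewrite -subr_eq0 -dotBr; apply/eqP.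
  have [->|sv] := eqVneq s v; first by rewrite subrr dot0r.
  have := uv s sS sv; rewrite neq_lt => /orP[/(mq s sS)//|su].
  have := mr s q0 sS q0S su q0u; rewrite dr mq // mulr0 sub0r => /eqP.
  by rewrite oppr_eq0 mulf_eq0 lt_eqF ?dn //= => /eqP.
have [m1 [m2 [x1 [x2 h]]]] :=
  pencil_two sup zS' (dot0r _) wconst (S'r _ _ p0S q0S p0u q0u) x0c ND.
move: h; set G := fun m => _.
move=> [[sup1 sup2] [[k1 [l1 m1E]] [k2 [l2 m2E]]] [[x1S x1c Gx1] [x2S x2c Gx2]] G12 uniq].
have facet m k l x : supports S' m (dot m 0) -> m = k *: (- w) + l *: cross u w ->
    x \in S' -> dot (- w) x < 0 -> G m x ->
    exists F, [/\ facets P F, crosses S u F v & forall p' q', p' \in S -> q' \in S ->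
      dot u v < dot u p' -> dot u q' < dot u v -> dot m (r p' q') = 0 <-> F p' /\ F q'].
  move=> [m0 mle _] mE /S'P[->|[p [q [pS qS pu qu xE]]]]; first by rewrite dot0r ltxx.
  move=> _ [_]; rewrite /plane /= dot0r xE => mr.
  apply: (@lift m p q) => //; first by rewrite mE in m0 *; exact: free0.
  by move=> y /mle; rewrite dot0r.
have [F1 [fac1 cr1 F1P]] := facet _ _ _ _ sup1 m1E x1S x1c Gx1.
have [F2 [fac2 cr2 F2P]] := facet _ _ _ _ sup2 m2E x2S x2c Gx2.
have Gr m p q : p \in S -> q \in S -> dot u v < dot u p -> dot u q < dot u v ->
    G m (r p q) <-> dot m (r p q) = 0.
  move=> pS qS pu qu; split=> [[_]|h]; rewrite /plane /= ?dot0r //.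
  by split; [apply/sub_convex_hull/S'r|rewrite /plane /= dot0r].
exists F1, F2; split=> //.
  move=> F12; apply: G12; apply: (@face_ext _ _ S').
  - by apply/face_hull; exists m1, (dot m1 0).
  - by apply/face_hull; exists m2, (dot m2 0).
  - move=> x /S'P[->|[p [q [pS qS pu qu ->]]]].
      have z m : G m 0 by split=> //; apply: sub_convex_hull.
      by split=> _; exact: z.
    by rewrite !Gr // F1P // F2P // F12.
move=> F facF [Fv [p [pS Fp pu]] [q [qS Fq qu]]]; have [hF _] := facF.
have [m [e [[m0 mle _] FE]]] := (face_hull _ _).1 hF.
have ve : e = dot m v by move: Fv; rewrite FE => -[].
have mv x : F x -> dot m (x - v) = 0.
  by rewrite FE ve dotBr => -[_ ->]; rewrite subrr.
have mle' x : x \in S -> dot m (x - v) <= 0 by move=> /mle; rewrite ve dotBr subr_le0.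
(* The normal of a crossing facet is written in the basis [u], [w], [cross u w]; dropping the [u]
   part keeps its values on the vectors [r p' q'] and lands in the pencil. *)
have mE := cross_basis m n0.
set g := _ / _ in mE; set a := _ / _ in mE; set b := _ / _ in mE.
pose M := (- a) *: (- w) + b *: cross u w.
have ME : m = M + g *: u by rewrite {1}mE /M scaleNr scalerN opprK -addrA [LHS]addrC.
have Mr p' q' : dot M (r p' q') = dot m (r p' q').
  by rewrite ME (dotDl M) dotZl ur mulr0 addr0.
have supM : supports S' M 0.
  split; last by exists 0; rewrite ?dot0r.
    apply: contra_neq m0 => M0; rewrite ME M0 add0r.
    have := mv p Fp; rewrite ME M0 add0r dotZl => /eqP.
    by rewrite mulf_eq0 (gt_eqF (up p pu)) orbF => /eqP ->; rewrite scale0r.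
  move=> x /S'P[->|[p' [q' [p'S q'S p'u q'u ->]]]]; first by rewrite dot0r.
  rewrite Mr dr; have h1 : dot u (p' - v) * dot m (q' - v) <= 0.
    by rewrite pmulr_rle0 ?up // mle'.
  have h2 : 0 <= dot u (q' - v) * dot m (p' - v) by rewrite nmulr_rge0 ?dn // mle'.
  lra.
have mr0 : dot M (r p q) = 0 by rewrite Mr dr !mv // !mulr0 subrr.
have rS' := S'r p q pS qS pu qu.
(* [F] and [F'] share [v], [p] and [q], which are noncollinear. *)
have conclude F' m' : facets P F' -> crosses S u F' v -> (forall p' q', p' \in S -> q' \in S ->
      dot u v < dot u p' -> dot u q' < dot u v -> dot m' (r p' q') = 0 <-> F' p' /\ F' q') ->
    convex_hull [set` S'] `&` plane M 0 = G m' -> F = F'.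
  move=> [hF' _] [F'v _ _] F'P GE.
  have [F'p F'q] : F' p /\ F' q.
    apply/F'P => //; apply/Gr => //; rewrite -GE; split=> //; exact: sub_convex_hull.
  apply: (facets_eq full hF hF' vS (y := p) (z := q)) => //.
  apply/negP => /eqP /cross_eq0; rewrite subr_eq0 nv ?gt_eqF // => /(_ isT) qE.
  have := wr p q pS qS pu qu; rewrite /r qE; set l := _ / _.
  by rewrite scalerA dotZr mulrC -scalerBl subrr scale0r dot0r ltxx.
have Mle : dot (- w) (r p q) < 0 by rewrite dotNl oppr_lt0 wr.
have Gv : (convex_hull [set` S'] `&` plane M 0) 0.
  by split; [exact: sub_convex_hull|exact: dot0r].
have Gpq : (convex_hull [set` S'] `&` plane M 0) (r p q).
  by split=> //; exact: sub_convex_hull.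
have [GE|GE] := uniq _ _ _ _ _ supM erefl Gv rS' Mle Gpq.
- by left; apply: conclude fac1 cr1 F1P GE.
- by right; apply: conclude fac2 cr2 F2P GE.
Qed.

End Crossing.

(** * Double counting *)

Section Counting.

Lemma count_sumE (T : Type) (p : pred T) (s : seq T) : count p s = (\sum_(x <- s) p x)%N.
Proof. by elim: s => [|x s IH]; rewrite ?big_nil // big_cons -IH. Qed.

Lemma exchange_count (X Y : Type) (I : X -> Y -> bool) (s : seq X) (t : seq Y) :
  (\sum_(x <- s) count (I x) t = \sum_(y <- t) count (I^~ y) s)%N.
Proof.
under eq_bigr => x _ do rewrite count_sumE.
by rewrite exchange_big; apply: eq_bigr => y _; rewrite count_sumE.
Qed.

Lemma sum_const_seq (T : eqType) (s : seq T) (f : T -> nat) k :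
  {in s, forall x, f x = k} -> (\sum_(x <- s) f x = k * size s)%N.
Proof.
move=> h; rewrite (eq_big_seq _ h) big_const_seq count_predT iter_addn addn0.
by [].
Qed.

(** Sorted by the common [y], the ordered pairs form the product of the fibre at [y] with itself,
    whence the square. *)
Lemma exchange_count_sq (X Y : Type) (I : X -> Y -> bool) (s : seq X) (t : seq Y) :
  (\sum_(x <- s) \sum_(x' <- s) count (fun y => I x y && I x' y) t
   = \sum_(y <- t) count (I^~ y) s ^ 2)%N.
Proof.
under eq_bigr => x _.
  under eq_bigr => x' _ do rewrite count_sumE.
  rewrite exchange_big; over.
rewrite exchange_big; apply: eq_bigr => y _ /=.
rewrite -mulnn {1}count_sumE big_distrl; apply: eq_bigr => x _ /=.
rewrite count_sumE big_distrr; apply: eq_bigr => x' _ /=.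
by rewrite mulnb.
Qed.

(** The double sums differ only on the diagonal. Each diagonal is added to the opposite side, which
    avoids subtraction in [nat]. *)
Lemma sum_offdiag (T : eqType) (s : seq T) (f g : T -> T -> nat) : uniq s ->
  {in s &, forall x y, x != y -> f x y = g x y} ->
  (\sum_(x <- s) \sum_(y <- s) f x y + \sum_(x <- s) g x x
   = \sum_(x <- s) \sum_(y <- s) g x y + \sum_(x <- s) f x x)%N.
Proof.
move=> us fg; rewrite -!big_split; apply: eq_big_seq => x xs /=.
rewrite !(bigD1_seq x) //=.
have -> : (\sum_(y <- s | y != x) f x y = \sum_(y <- s | y != x) g x y)%N.
  rewrite big_seq_cond [RHS]big_seq_cond; apply: eq_bigr => y /andP[ys yx].
  by rewrite fg // eq_sym.
lia.
Qed.

Lemma big_two (T : eqType) (M : nmodType) (s : seq T) (Q : pred T) (g : T -> M) a b :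
  uniq s -> a \in s -> b \in s -> a != b -> {in s, forall x, Q x = (x == a) || (x == b)} ->
  \sum_(x <- s | Q x) g x = g a + g b.
Proof.
move=> us sa sb ab hQ; rewrite -big_filter (perm_big [:: a; b]).
  by rewrite big_cons big_seq1.
apply: uniq_perm; rewrite ?filter_uniq //= ?inE ?ab //.
move=> x; rewrite mem_filter !inE; case xs: (x \in s); first by rewrite hQ // andbT.
rewrite andbF; apply/esym/negP => /orP[] /eqP xE; by rewrite xE ?sa ?sb in xs.
Qed.

Lemma count_two (T : eqType) (s : seq T) (Q : pred T) a b :
  uniq s -> a \in s -> b \in s -> a != b -> {in s, forall x, Q x = (x == a) || (x == b)} ->
  count Q s = 2%N.
Proof. by move=> us sa sb ab hQ; rewrite -sum1_count (big_two _ us sa sb ab hQ). Qed.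

Lemma sum_fibers (X Y : eqType) (M : nmodType) (s : seq X) (t : seq Y) (f : X -> Y)
    (g : X -> M) : uniq t -> {in s, forall x, f x \in t} ->
  \sum_(x <- s) g x = \sum_(y <- t) \sum_(x <- s | f x == y) g x.
Proof.
move=> ut ft; rewrite (exchange_big_dep xpredT) //=; apply: eq_big_seq => x xs.
by rewrite -big_filter (perm_big [:: f x]) ?big_seq1 // uniq_perm ?filter_uniq // => y;
   rewrite mem_filter inE eq_sym; case: eqVneq => // ->; rewrite ft.
Qed.

Lemma mem_fset_set (T : choiceType) (A : set T) x : finite_set A ->
  x \in (fset_set A : seq T) <-> A x.
Proof. by move=> fA; split=> [|Ax]; rewrite in_fset_set // ?inE // => /set_mem. Qed.

(** The map from ordered pairs [(x, y)] to [[set x; y]] has fibres of exactly two elements, because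
    the relation is symmetric and the members are distinct. *)
Lemma card_unordered_pairs (T : choiceType) (A : set T) (r : T -> T -> Prop) :
  finite_set A -> (forall x y, r x y -> r y x) ->
  ((card_of (unordered_pairs A r)).*2
   = \sum_(x <- fset_set A) count (fun y => `[< x <> y /\ r x y >]) (fset_set A))%N.
Proof.
move=> fA rsym; set s : seq T := fset_set A.
have us : uniq s by exact: fset_uniq.
have sP x : x \in s <-> A x by exact: mem_fset_set.
pose L := [seq z <- [seq (x, y) | x <- s, y <- s] | `[< z.1 <> z.2 /\ r z.1 z.2 >]].
have LP x y : (x, y) \in L <-> [/\ A x, A y, x <> y & r x y].
  rewrite mem_filter; split=> [/andP[/asboolP /= [xy rxy] /allpairsP[[a b] /= [as_ bs [xE
    yE]]]]|[Ax Ay xy rxy]].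
    by move: as_ bs; rewrite -xE -yE => /sP Ax /sP Ay; split.
  apply/andP; split; first exact/asboolP.
  have xs : x \in s by apply/sP.
  have ys : y \in s by apply/sP.
  by apply/allpairsP; exists (x, y).
have uL : uniq L by rewrite filter_uniq // allpairs_uniq // => -[? ?] [? ?].
pose f (z : T * T) : set T := [set z.1; z.2].
have PE : unordered_pairs A r = f @` [set` L].
  apply/seteqP; split=> [_ [a [b [Aa Ab ab rab ->]]]|_ [[a b] /LP[Aa Ab ab rab] <-]].
    by exists (a, b) => //; apply/LP.
  by exists a, b.
have fP : finite_set (unordered_pairs A r) by rewrite PE; apply: finite_image.
set t : seq (set T) := fset_set (unordered_pairs A r).
have ut : uniq t by exact: fset_uniq.
have tP y : y \in t <-> unordered_pairs A r y by exact: mem_fset_set.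
have -> : (\sum_(x <- s) count (fun y => `[< x <> y /\ r x y >]) s = \sum_(z <- L) 1)%N.
  rewrite /L big_filter [RHS]big_mkcond big_allpairs_dep /=; apply: eq_bigr => x _.
  by rewrite -sum1_count big_mkcond.
rewrite (sum_fibers (t := t) (f := f) _ ut); last first.
  by move=> [a b] /LP[Aa Ab ab rab]; apply/tP; exists a, b.
rewrite (sum_const_seq (k := 2%N)) ?mul2n // => y /tP[a [b [Aa Ab ab rab ->]]].
rewrite (@big_two _ _ _ _ _ (a, b) (b, a)) //.
- exact/LP.
- by apply/LP; split=> //; [move=> ba; apply: ab|exact: rsym].
- by apply/eqP => -[ab' _]; apply: ab.
- move=> [x z] /LP[_ _ xz _]; apply/eqP/orP => [|[/eqP[-> ->] //|/eqP[-> ->]]]; last first.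
    by rewrite /f /= setUC.
  rewrite /f /= => E.
  have : [set a; b] x by rewrite -E; left.
  have : [set a; b] z by rewrite -E; right.
  by move=> [] /= zE [] /= xE; rewrite xE zE ?eqxx in xz *; [|right|left|].
Qed.

End Counting.

(** * Euler's formula *)

Section Enumerations.
Context {R : realType}.
Local Notation V := 'rV[R]_3.
Implicit Types (F G P E : set V) (S : seq V) (u v w x y z d m p q : V) (a b t k : R).

Definition vertex_seq P : seq V := fset_set (vertices P).
Definition edge_seq P : seq (set V) := fset_set (edges P).
Definition facet_seq P : seq (set V) := fset_set (facets P).

Lemma vertex_seq_uniq P : uniq (vertex_seq P). Proof. exact: fset_uniq. Qed.
Lemma edge_seq_uniq P : uniq (edge_seq P). Proof. exact: fset_uniq. Qed.
Lemma facet_seq_uniq P : uniq (facet_seq P). Proof. exact: fset_uniq. Qed.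

Lemma finite_vertices S : finite_set (vertices (convex_hull [set` S])).
Proof. by apply: sub_finite_set (finite_seq S) => v /vertex_mem. Qed.

Lemma finite_edges S : finite_set (edges (convex_hull [set` S])).
Proof. exact: finite_pred_faces. Qed.

Lemma finite_facets S : finite_set (facets (convex_hull [set` S])).
Proof. exact: finite_pred_faces. Qed.

Lemma vertex_seqP S v :
  v \in vertex_seq (convex_hull [set` S]) <-> vertices (convex_hull [set` S]) v.
Proof. apply: mem_fset_set; exact: finite_vertices. Qed.

Lemma edge_seqP S E : E \in edge_seq (convex_hull [set` S]) <-> edges (convex_hull [set` S]) E.
Proof. apply: mem_fset_set; exact: finite_edges. Qed.

Lemma facet_seqP S F :
  F \in facet_seq (convex_hull [set` S]) <-> facets (convex_hull [set` S]) F.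
Proof. apply: mem_fset_set; exact: finite_facets. Qed.

Lemma face_hull2 S F x y (P := convex_hull [set` S]) : face P F -> vertices P x ->
  vertices P y ->
  F x -> F y -> convex_hull [set x; y] `<=` F.
Proof.
move=> /face_hull[u [a [_ ->]]] vx vy [_ xa] [_ ya] z hz; split.
  by apply: convex_hull_mono hz => _ [] ->; apply: vertex_mem.
move: hz => /convex_hull2P[t [_ ->]]; rewrite /plane /= dotDr dotZr dotBr.
by move: xa ya; rewrite /plane /= => -> ->; rewrite subrr mulr0 addr0.
Qed.

Lemma count_edge_vertices S E (P := convex_hull [set` S]) : edges P E ->
  count (fun v => `[< E v >]) (vertex_seq P) = 2%N.
Proof.
move=> hE; have [a [b [ab va vb EE hv]]] := edge_ends hE.
have Ea : E a by rewrite EE; apply: sub_convex_hull; left.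
have Eb : E b by rewrite EE; apply: sub_convex_hull; right.
apply: (@count_two _ _ _ a b); rewrite ?vertex_seq_uniq //; try exact/vertex_seqP.
  exact/eqP.
move=> x /vertex_seqP vx; apply/asboolP/orP => [/(hv x vx)[]->|[]/eqP->] //.
  by left.
by right.
Qed.

Lemma count_edge_facets S E (P := convex_hull [set` S]) : full_dim P -> edges P E ->
  count (fun F => `[< E `<=` F >]) (facet_seq P) = 2%N.
Proof.
move=> full hE; have [F1 [F2 [F12 [f1 E1] [f2 E2] h]]] := edge_two_facets full hE.
apply: (@count_two _ _ _ F1 F2); rewrite ?facet_seq_uniq //; try exact/facet_seqP.
  exact/eqP.
move=> F /facet_seqP fF; apply/asboolP/orP => [/(h F fF)[]->|[]/eqP->] //.
  by left.
by right.
Qed.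

(** A polygon has as many vertices as edges: its incidences number two per edge and two per
    vertex. *)
Lemma count_facet S F (P := convex_hull [set` S]) : full_dim P -> facets P F ->
  count (fun v => `[< F v >]) (vertex_seq P) = count (fun E => `[< E `<=` F >]) (edge_seq P).
Proof.
move=> full fF.
pose VF := [seq v <- vertex_seq P | `[< F v >]].
pose EF := [seq E <- edge_seq P | `[< E `<=` F >]].
have VFP v : v \in VF <-> vertices P v /\ F v.
  by rewrite mem_filter;
    split=> [/andP[/asboolP hv /vertex_seqP]|[/vertex_seqP -> /asboolP ->]].
have EFP E : E \in EF <-> edges P E /\ E `<=` F.
  by rewrite mem_filter; split=> [/andP[/asboolP hE /edge_seqP]|[/edge_seqP -> /asboolP ->]].
rewrite -!size_filter -/VF -/EF; apply/eqP; rewrite -(eqn_pmul2l (isT : 0 < 2)%N); apply/eqP.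
have := exchange_count (fun v E => `[< E v >]) VF EF.
rewrite (sum_const_seq (k := 2%N)); last first.
  move=> v /VFP[vv Fv]; have [E1 [E2 [E12 [e1 E1v E1F] [e2 E2v E2F] h]]] :=
    facet_vertex_two_edges full fF vv Fv.
  apply: (@count_two _ _ _ E1 E2); rewrite ?filter_uniq ?edge_seq_uniq //; try exact/EFP.
    exact/eqP.
  move=> E /EFP[eE EsF]; apply/asboolP/orP => [Ev|[]/eqP->] //.
  by have [->|->] := h E eE Ev EsF; rewrite eqxx; [left|right].
rewrite (sum_const_seq (k := 2%N)) // => E /EFP[eE EsF].
rewrite count_filter -[RHS](count_edge_vertices eE); apply: eq_in_count => v /vertex_seqP vv /=.
by case: asboolP => // Ev; apply/asboolP/EsF.
Qed.

Lemma sum_facets S (P := convex_hull [set` S]) : full_dim P ->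
  (\sum_(F <- facet_seq P) count (fun v =>
    `[< F v >]) (vertex_seq P) = 2 * size (edge_seq P))%N.
Proof.
move=> full; rewrite -(sum_const_seq (f := fun E => count (fun F =>
  `[< E `<=` F >]) (facet_seq P))).
  rewrite [RHS]exchange_count; apply: eq_big_seq => F /facet_seqP fF; exact: count_facet.
by move=> E /edge_seqP; apply: count_edge_facets.
Qed.

Lemma exists_notin (s : seq R) : exists t, t \notin s.
Proof.
have [x xs hx] := seq_argmax id (mem_head 0 s).
exists (x + 1); apply/negP => h; have := hx (x + 1); rewrite inE h orbT => /(_ isT).
by rewrite /= gerDl ler10.
Qed.

(** Each nonzero vector excludes a hyperplane of directions; [u] is corrected along each new [d] by
    a multiple avoiding finitely many values. *)
Lemma generic_direction (s : seq V) : 0 \notin s -> exists u, {in s, forall d, dot u d != 0}.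
Proof.
elim: s => [|d s IH]; first by exists 0.
rewrite inE negb_or eq_sym => /andP[d0 /IH[u hu]].
(* The listed values are the zeros in [t] of [dot (u + t *: d) d']. For [d'] orthogonal to [d] the
   quotient takes the default value 0, and that case is settled apart. *)
have [t] := exists_notin [seq - dot u d' / dot d d' | d' <- d :: s].
move=> ht; exists (u + t *: d) => d' d's; rewrite dotDl dotZl.
have [dd'|dd'] := eqVneq (dot d d') 0.
  rewrite dd' mulr0 addr0; move: d's dd'; rewrite inE => /orP[/eqP->/eqP|/hu //].
  by rewrite dot_eq0 (negbTE d0).
apply: contraNneq ht => h; apply/mapP; exists d' => //.
have -> : - dot u d' = t * dot d d' by lra.
by rewrite mulfK.
Qed.

Lemma hull_top S u : u != 0 -> {in S &, injective (dot u)} -> (exists x, x \in S) ->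
  exists t : V, [/\ t \in S, face (convex_hull [set` S]) [set t] & {in S, forall s, s != t ->
    dot u s < dot u t}].
Proof.
move=> u0 inj [x xS]; have [t tS ht] := seq_argmax (dot u) xS.
have lt : {in S, forall s, s != t -> dot u s < dot u t}.
  move=> s sS st; rewrite lt_neqAle ht // andbT.
  by apply: contra_neq st; apply: inj.
exists t; split=> //; apply/vertexP; exists (- u); rewrite oppr_eq0; split=> // s sS st.
by rewrite dotNl dotBr opprB subr_gt0 lt.
Qed.

Lemma face_top S F u (P := convex_hull [set` S]) : u != 0 -> {in S &, injective (dot u)} ->
  face P F -> exists t : V, [/\ vertices P t, F t & {in S, forall s, F s -> s != t ->
    dot u s < dot u t}].
Proof.
move=> u0 inj hF; have [x xS Fx] := face_pt hF.
have [||t [tF vt lt]] := @hull_top [seq s <- S | `[< F s >]] u u0.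
- by move=> y z; rewrite !mem_filter => /andP[_ yS] /andP[_ zS]; apply: inj.
- by exists x; rewrite mem_filter xS andbT; apply/asboolP.
move: tF; rewrite mem_filter => /andP[/asboolP Ft tS].
exists t; split=> //; first by apply: (face_trans hF); rewrite (face_pts hF).
by move=> s sS Fs; apply: lt; rewrite mem_filter sS andbT; apply/asboolP.
Qed.

(* Double counting of the pairs [(F, v)] with [v] neither the top nor the bottom
   of [F]: a facet has [e F - 2] such vertices, and a vertex has two such facets
   unless it is the top or the bottom of [P]. *)
Lemma euler S (P := convex_hull [set` S]) : full_dim P ->
  (size (vertex_seq P) + size (facet_seq P) = size (edge_seq P) + 2)%N.
Proof.
move=> full.
have e0 : (delta_mx 0 0 : V) != 0.
  by apply/eqP => /(congr1 (fun x : V => x 0 0)) /eqP; rewrite !mxE /= oner_eq0.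
(* The nonzero differences make [u] injective on [S]; the extra basis vector makes [u] nonzero
   whatever [S] is. *)
have [|u hu] := @generic_direction (delta_mx 0 0 :: [seq d <- [seq x - y | x <- S, y <- S] |
  d != 0]).
  by rewrite inE negb_or eq_sym e0 mem_filter eqxx.
have u0 : u != 0.
  by have := hu _ (mem_head _ _); apply: contra_neq => ->; rewrite dot0l.
have inj : {in S &, injective (dot u)}.
  move=> x y xS yS xy; apply: contrapT => /eqP nxy.
  have /hu : x - y \in delta_mx 0 0 :: [seq d <- [seq x - y | x <- S, y <- S] | d != 0].
    rewrite inE mem_filter subr_eq0 nxy; apply/orP; right.
    by apply/allpairsP; exists (x, y).
  by rewrite dotBr xy subrr eqxx.
have injN : {in S &, injective (dot (- u))}.
  by move=> x y xS yS; rewrite !dotNl => /oppr_inj; apply: inj.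
have nu0 : - u != 0 by rewrite oppr_eq0.
have Sne : exists x, x \in S.
  apply: contrapT => /forallNP h; case/eqP: u0.
  by apply: (full_dim_pts full (a := 0)) => s /h.
have [T [TS vT ltT]] := hull_top u0 inj Sne.
have [B [BS vB ltB]] := hull_top nu0 injN Sne.
have ltB' s : s \in S -> s != B -> dot u B < dot u s.
  by move=> sS /(ltB s sS); rewrite !dotNl ltrN2.
have TB : T != B.
  apply/eqP => TB; case/eqP: u0; apply: (full_dim_pts full (a := dot u T)) => s sS.
  have [->//|sT] := eqVneq s T.
  by have := ltT s sS sT; have := ltB' s sS; rewrite -TB => /(_ sT)/lt_trans h/h; rewrite ltxx.
have facetE F : facets P F ->
    (count (fun v => `[< crosses S u F v >]) (vertex_seq P) + 2
     = count (fun v => `[< F v >]) (vertex_seq P))%N.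
  move=> [hF dF].
  have [t [vt Ft ltt]] := face_top u0 inj hF.
  have [b [vb Fb ltb]] := face_top nu0 injN hF.
  have ltb' s : s \in S -> F s -> s != b -> dot u b < dot u s.
    by move=> sS Fs /(ltb s sS Fs); rewrite !dotNl ltrN2.
  have tS := vertex_mem vt; have bS := vertex_mem vb.
  have tb : t != b.
    apply/eqP => tb; have [x [y [z [[xS yS zS] [Fx Fy Fz]]]]] := (facetP hF).1 (conj hF dF).
    have all_t s : s \in S -> F s -> s = t.
      move=> sS Fs; apply: contrapT => /eqP st.
      by have := ltt s sS Fs st; have := ltb' s sS Fs; rewrite -tb => /(_ st)/lt_trans h/h;
        rewrite ltxx.
    rewrite (all_t x) // (all_t y) // (all_t z) // /noncollinear subrr; apply/negP;
      rewrite negbK; apply/eqP.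
    by apply: row3P; rewrite !crossE !mxE; ring.
  have tb2 : count (fun v => (v == t) || (v == b)) (vertex_seq P) = 2%N.
    apply: (@count_two _ _ _ t b); rewrite ?vertex_seq_uniq //; exact/vertex_seqP.
  rewrite -[X in (_ + X)%N = _]tb2 -[RHS]addn0.
  rewrite -(count_predUI (fun v => `[< crosses S u F v >])); congr (_ + _)%N.
    apply: eq_in_count => v /vertex_seqP vv /=; have vS := vertex_mem vv.
    apply/orP/asboolP => [[/asboolP[]//|/orP[]/eqP->//]|Fv].
    have [->|vt'] := eqVneq v t; first by right.
    have [->|vb'] := eqVneq v b; first by right; rewrite orbT.
    by left; apply/asboolP; split=> //; [exists t|exists b]; split=> //;
      [exact: ltt|exact: ltb'].
  rewrite (eq_in_count (a2 := pred0)) ?count_pred0 // => v /vertex_seqP vv /=;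
    have vS := vertex_mem vv.
  apply/negP => /andP[/asboolP[Fv [p [pS Fp pu]] [q [qS Fq qu]]] /orP[]/eqP vE].
    have [pv|pv] := eqVneq p v; first by rewrite pv ltxx in pu.
    by have := ltt p pS Fp; rewrite -vE => /(_ pv) /(lt_trans pu); rewrite ltxx.
  have [qv|qv] := eqVneq q v; first by rewrite qv ltxx in qu.
  by have := ltb' q qS Fq; rewrite -vE => /(_ qv) /(lt_trans qu); rewrite ltxx.
(* The top and the bottom of [P] lie in no crossing facet; the boolean term makes up for the missing
   two. *)
have vertexE v : vertices P v ->
    (count (fun F => `[< crosses S u F v >]) (facet_seq P) + 2 * ((v == T) || (v == B)) = 2)%N.
  move=> vv; have vS := vertex_mem vv.
  have [ext|next] := boolP ((v == T) || (v == B)).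
    rewrite (eq_in_count (a2 := pred0)) ?count_pred0 // => F _.
    apply/negP => /asboolP[Fv [p [pS Fp pu]] [q [qS Fq qu]]].
    move: ext => /orP[]/eqP vE.
      have [pv|pv] := eqVneq p v; first by rewrite pv ltxx in pu.
      by have := ltT p pS; rewrite -vE => /(_ pv) /(lt_trans pu); rewrite ltxx.
    have [qv|qv] := eqVneq q v; first by rewrite qv ltxx in qu.
    by have := ltB' q qS; rewrite -vE => /(_ qv) /(lt_trans qu); rewrite ltxx.
  move: next; rewrite negb_or => /andP[vT' vB'].
  have [|||F1 [F2 [F12 [f1 c1] [f2 c2] h]]] := @vertex_two_crossings _ S u v full vv.
  - by move=> s sS; apply: contra_neq; apply: inj.
  - by exists T => //; apply: ltT.
  - by exists B => //; apply: ltB'.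
  rewrite muln0 addn0; apply: (@count_two _ _ _ F1 F2); rewrite ?facet_seq_uniq //;
    try exact/facet_seqP.
    exact/eqP.
  move=> F /facet_seqP fF; apply/asboolP/orP => [/(h F fF)[]->|[]/eqP->] //.
    by left.
  by right.
have TB2 : count (fun v => (v == T) || (v == B)) (vertex_seq P) = 2%N.
  apply: (@count_two _ _ _ T B); rewrite ?vertex_seq_uniq //; exact/vertex_seqP.
have sF : (\sum_(F <- facet_seq P) count (fun v => `[< crosses S u F v >]) (vertex_seq P)
    + 2 * size (facet_seq P) = 2 * size (edge_seq P))%N.
  rewrite -sum_facets // -(sum_const_seq (f := fun=> 2%N) (s := facet_seq P)) // -big_split.
  by apply: eq_big_seq => F /facet_seqP /facetE.
have sV : (\sum_(v <- vertex_seq P) count (fun F => `[< crosses S u F v >]) (facet_seq P)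
    + 4 = 2 * size (vertex_seq P))%N.
  have -> : 4%N = (2 * count (fun v => (v == T) || (v == B)) (vertex_seq P))%N by rewrite TB2.
  rewrite count_sumE big_distrr -big_split /=.
  by apply: sum_const_seq => v /vertex_seqP /vertexE.
(* With f the number of facets, the two counts give 2E - 2f = 2V - 4. *)
have := exchange_count (fun v F => `[< crosses S u F v >]) (vertex_seq P) (facet_seq P).
move: sF sV; set s1 := \sum_(F <- _) _; set s2 := \sum_(v <- _) _; lia.
Qed.

End Enumerations.

(** * Central symmetry *)

Section Reflection.
Context {R : realType} {n : nat}.
Local Notation V := 'rV[R]_n.
Implicit Types (A F P E : set V) (S : seq V) (c u x y m : V) (a : R).

Lemma point_reflectionK c : involutive (point_reflection c).
Proof. by move=> x; rewrite /point_reflection opprB addrC subrK. Qed.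

Lemma reflection_imageK c A : point_reflection c @` (point_reflection c @` A) = A.
Proof.
apply/seteqP; split=> [_ [_ [x Ax <-] <-]|x Ax]; first by rewrite point_reflectionK.
by exists (point_reflection c x); [exists x|rewrite point_reflectionK].
Qed.

Lemma reflection_imageP c A x : (point_reflection c @` A) x <-> A (point_reflection c x).
Proof.
split=> [[y Ay <-]|Ax]; first by rewrite point_reflectionK.
by exists (point_reflection c x); rewrite ?point_reflectionK.
Qed.

Lemma dot_reflection c u x : dot u (point_reflection c x) = dot u c *+ 2 - dot u x.
Proof. by rewrite dotBr -scaler_nat dotZr mulr_natl. Qed.

Lemma reflection_sum c k (p : 'I_k -> V) (t : 'I_k -> R) : \sum_i t i = 1 ->
  point_reflection c (\sum_i t i *: p i) = \sum_i t i *: point_reflection c (p i).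
Proof.
move=> t1; rewrite /point_reflection; under [RHS]eq_bigr => i _ do rewrite scalerBr.
by rewrite sumrB -scaler_suml t1 scale1r.
Qed.

Lemma reflection_affine_hull c A x : affine_hull A x ->
  affine_hull (point_reflection c @` A) (point_reflection c x).
Proof.
move=> [k [p [t [Ap t1 ->]]]]; exists k, (point_reflection c \o p), t.
by rewrite reflection_sum //; split=> // i; exists (p i).
Qed.

Lemma reflection_convex_hull c A :
  point_reflection c @` convex_hull A = convex_hull (point_reflection c @` A).
Proof.
have sub B : point_reflection c @` convex_hull B `<=` convex_hull (point_reflection c @` B).
  move=> _ [x [k [p [t [Ap t0 t1 ->]]]] <-]; exists k, (point_reflection c \o p), t.
  by rewrite reflection_sum //; split=> // i; exists (p i).
apply/seteqP; split=> // x hx; rewrite -[x](point_reflectionK c); apply/reflection_imageP.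
rewrite point_reflectionK -[A](reflection_imageK c); apply: sub; exact: imageP.
Qed.

Lemma reflection_has_dim c A k : has_dim A k -> has_dim (point_reflection c @` A) k.
Proof.
move=> [x0 [U [dU AU]]]; exists (point_reflection c x0), U; split=> //.
have tr x u : point_reflection c (x + u) = point_reflection c x - u.
  by rewrite /point_reflection opprD addrA.
apply/seteqP; split=> [x|_ [u uU <-]].
  move=> /(reflection_affine_hull c); rewrite reflection_imageK AU => -[u uU xE].
  exists (- u); first by rewrite /= rpredN.
  by rewrite -tr xE point_reflectionK.
rewrite -[u]opprK -tr; apply: reflection_affine_hull; rewrite AU.
by exists (- u); rewrite //= rpredN.
Qed.

Section Symmetric.
Context (c : V) (P : set V) (symP : centrally_symmetric c P).
Local Notation rho := (point_reflection c).

Lemma symmetric_mem x : P x -> P (rho x).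
Proof. by move=> Px; rewrite -symP; exists x. Qed.

Lemma reflection_face F : face P F -> face P (rho @` F).
Proof.
move=> [u [a [[u0 le [x Px xa]] FE]]]; exists (- u), (a - dot u c *+ 2); split.
  split; rewrite ?oppr_eq0 //.
    by move=> y /symmetric_mem /le; rewrite dot_reflection dotNl; lra.
  exists (rho x); first exact: symmetric_mem.
  by rewrite dotNl dot_reflection xa; lra.
apply/seteqP; split=> y.
  move/reflection_imageP; rewrite FE => -[/symmetric_mem Py]; rewrite point_reflectionK in Py.
  by rewrite /plane /= dot_reflection => h; split=> //; rewrite /plane /= dotNl; lra.
move=> [Py]; rewrite /plane /= dotNl => h; apply/reflection_imageP; rewrite FE.
by split; [apply: symmetric_mem|rewrite /plane /= dot_reflection; lra].
Qed.

Lemma reflection_vertex v : vertices P v -> vertices P (rho v).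
Proof. by move=> /reflection_face; rewrite image_set1. Qed.

Lemma reflection_edge E : edges P E -> edges P (rho @` E).
Proof. by move=> [/reflection_face hE /(reflection_has_dim c)]. Qed.

Lemma reflection_facet F : facets P F -> facets P (rho @` F).
Proof. by move=> [/reflection_face hF /(reflection_has_dim c)]. Qed.

(** A plane through [x] and its reflection contains [c]; if it supports [P], symmetry bounds [P]
    from the other side too and confines it to the plane, which full dimension excludes. *)
Lemma face_reflection_disjoint F x : full_dim P -> face P F -> F x -> ~ F (rho x).
Proof.
move=> full [u [a [[u0 le _] ->]]] [Px xa] [_]; rewrite /plane /= dot_reflection xa => h.
case/eqP: u0; apply: (full u a) => y Py; apply/eqP; rewrite eq_le le //=.
by have := le _ (symmetric_mem Py); rewrite dot_reflection; lra.
Qed.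

Lemma antipodal_sym x y : antipodal P x y -> antipodal P y x.
Proof.
move=> [Px Py [u [a [b [u0 xa yb h]]]]]; split=> //.
exists (- u), (- b), (- a); rewrite oppr_eq0; split=> //.
- by move: yb; rewrite /plane /= dotNl => ->.
- by move: xa; rewrite /plane /= dotNl => ->.
- by move=> z /h; rewrite dotNl !lerN2 andbC.
Qed.

(** The values of [u] on [P] are symmetric about [dot u c], so the reflection of [y] attains the
    extreme level of [x]; conversely, reflecting a supporting plane yields the opposite one. *)
Lemma antipodal_face x y : antipodal P x y <-> exists F, [/\ face P F, F x & F (rho y)].
Proof.
split=> [[Px Py [u [a [b [u0 xa yb h]]]]]|[_ [[u [a [[u0 le _] ->]]] [Px xa] [Pry ya]]]].
  have ya : dot u (rho y) = a.
    have := h _ (symmetric_mem Px); have := h _ (symmetric_mem Py).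
    rewrite !dot_reflection xa yb; lra.
  exists (P `&` plane (- u) (- a)); split.
  - exists (- u), (- a); split=> //; split; rewrite ?oppr_eq0 //.
      by move=> z /h /andP[h1 _]; rewrite dotNl lerN2.
    by exists x; rewrite ?dotNl ?xa.
  - by split=> //; move: xa; rewrite /plane /= dotNl => ->.
  - by split; [apply: symmetric_mem|rewrite /plane /= dotNl ya].
split=> //; first by rewrite -[y](point_reflectionK c); apply: symmetric_mem.
exists (- u), (- a), (a - dot u c *+ 2); rewrite oppr_eq0; split=> //.
- by move: xa; rewrite /plane /= dotNl => ->.
- by move: ya; rewrite /plane /= dotNl dot_reflection; lra.
- move=> z Pz; have := le _ Pz; have := le _ (symmetric_mem Pz).
  by rewrite dotNl dot_reflection; lra.
Qed.

End Symmetric.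

(** The functional is at most [e] at both ends and averages to [e] at the midpoint, so it equals [e]
    at both: a midpoint on a face stands for the whole edge. *)
Lemma midpoint_face P F E m : face P F -> E `<=` P -> midpoint_of E m -> F m -> E `<=` F.
Proof.
move=> [u [e [[u0 le _] ->]]] EP [a [b [EE ->]]] [_].
rewrite /plane /= dotZr dotDr => h x Ex; split; first exact: EP.
have ha : dot u a <= e by apply/le/EP; rewrite EE; apply: sub_convex_hull; left.
have hb : dot u b <= e by apply/le/EP; rewrite EE; apply: sub_convex_hull; right.
have ae : dot u a = e by lra.
have be : dot u b = e by lra.
move: Ex; rewrite EE => /convex_hull2P[t [_ ->]].
by rewrite /plane /= dotDr dotZr dotBr ae be subrr mulr0 addr0.
Qed.

Lemma midpoint_mem E m : midpoint_of E m -> E m.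
Proof.
move=> [a [b [-> ->]]]; apply/convex_hull2P; exists 2^-1; split; first lra.
by apply/rowP => i; rewrite !mxE; lra.
Qed.

Lemma reflection_midpoint c E m : midpoint_of E m ->
  midpoint_of (point_reflection c @` E) (point_reflection c m).
Proof.
move=> [a [b [-> ->]]]; exists (point_reflection c a), (point_reflection c b).
rewrite reflection_convex_hull image_setU !image_set1; split=> //.
by apply/rowP => i; rewrite /point_reflection (mulr2n c) !mxE; lra.
Qed.

End Reflection.

(** * The antipodal defect *)

Section Defect.
Context {R : realType}.
Local Notation V := 'rV[R]_3.
Implicit Types (F G E : set V) (S : seq V) (c u v w x y m : V).

(** Without a common facet there is no common edge. Otherwise the counts read 1 + 1 = 2 if the
    segment is an edge and 1 + 0 = 1 if not: a second common facet would meet the first in an edge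
    through both vertices. *)
Lemma count_common_facets S v w (P := convex_hull [set` S]) : full_dim P ->
    vertices P v -> vertices P w -> v != w ->
  ((`[< exists F, [/\ facets P F, F v & F w] >] : nat)
    + count (fun E => `[< E v >] && `[< E w >]) (edge_seq P)
  = count (fun F => `[< F v >] && `[< F w >]) (facet_seq P))%N.
Proof.
move=> full vv vw vw'; have vNw : v <> w by apply/eqP.
have edgeE E : edges P E -> E v -> E w -> E = convex_hull [set v; w].
  by move=> hE Ev Ew; apply: (edge_vertices hE).
case: asboolP => [[F [fF Fv Fw]]|none]; last first.
  rewrite !(eq_in_count (a2 := pred0)) ?count_pred0 // => [F /facet_seqP fF|E /edge_seqP eE].
    by apply/negP => /andP[/asboolP Fv /asboolP Fw]; apply: none; exists F.
  apply/negP => /andP[/asboolP Ev /asboolP Ew].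
  have [F [_ [_ [fF EF] _ _]]] := edge_two_facets full eE.
  by apply: none; exists F; split=> //; apply: EF.
have [eE|neE] := pselect (edges P (convex_hull [set v; w])).
  have -> : count (fun E => `[< E v >] && `[< E w >]) (edge_seq P) = 1%N.
    rewrite (eq_in_count (a2 := pred1 (convex_hull [set v; w]))).
      by rewrite count_uniq_mem ?edge_seq_uniq //; case: (_ \in _) ((edge_seqP _ _).2 eE).
    move=> E /edge_seqP eE' /=; apply/andP/eqP => [[/asboolP Ev /asboolP Ew]|->].
      exact: edgeE.
    by split; apply/asboolP/sub_convex_hull; [left|right].
  rewrite -[LHS]/2%N -[LHS](count_edge_facets full eE);
    apply: eq_in_count => G /facet_seqP [hG _].
  apply/asboolP/andP => [EG|[/asboolP Gv /asboolP Gw]]; last exact: (face_hull2 hG vv vw).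
  by split; apply/asboolP/EG/sub_convex_hull; [left|right].
rewrite (eq_in_count (a2 := pred0)) ?count_pred0 => [|E /edge_seqP eE]; last first.
  apply/negP => /andP[/asboolP Ev /asboolP Ew]; apply: neE.
  by rewrite -(edgeE E).
rewrite addn0 (eq_in_count (a2 := pred1 F)).
  by rewrite count_uniq_mem ?facet_seq_uniq //; case: (_ \in _) ((facet_seqP _ _).2 fF).
move=> G /facet_seqP fG /=; apply/andP/eqP => [[/asboolP Gv /asboolP Gw]|->]; last first.
  by split; apply/asboolP.
apply: contrapT => GF; apply: neE.
have eGF := facets_inter_edge full fG fF GF Gv Gw Fv Fw vNw.
by rewrite -(edgeE _ eGF).
Qed.

(** Two common facets would meet in a single edge, equal to both [E] and [E']. *)
Lemma count_common_edge_facets S E E' (P := convex_hull [set` S]) : full_dim P ->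
    edges P E -> edges P E' -> E != E' ->
  (`[< exists F, [/\ facets P F, E `<=` F & E' `<=` F] >] : nat)
  = count (fun F => `[< E `<=` F >] && `[< E' `<=` F >]) (facet_seq P).
Proof.
move=> full hE hE' EE'.
case: asboolP => [[F [fF EF E'F]]|none]; last first.
  rewrite (eq_in_count (a2 := pred0)) ?count_pred0 // => F /facet_seqP fF.
  by apply/negP => /andP[/asboolP EF /asboolP E'F]; apply: none; exists F.
rewrite (eq_in_count (a2 := pred1 F)).
  by rewrite count_uniq_mem ?facet_seq_uniq //; case: (_ \in _) ((facet_seqP _ _).2 fF).
move=> G /facet_seqP fG /=; apply/andP/eqP => [[/asboolP EG /asboolP E'G]|->]; last first.
  by split; apply/asboolP.
apply: contrapT => GF; move/eqP: EE'; apply.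
have sub D : edges P D -> D `<=` F -> D `<=` G -> edges P (G `&` F) /\ D = G `&` F.
  move=> hD DF DG; have [x [y [xy vx vy DE _]]] := edge_ends hD.
  have Dx : D x by rewrite DE; apply: sub_convex_hull; left.
  have Dy : D y by rewrite DE; apply: sub_convex_hull; right.
  have eGF := facets_inter_edge full fG fF GF (DG _ Dx) (DG _ Dy) (DF _ Dx) (DF _ Dy) xy.
  split=> //; rewrite DE; apply/esym; apply: (edge_vertices eGF) => //.
    by split; [exact: DG|exact: DF].
  by split; [exact: DG|exact: DF].
by rewrite (sub E hE EF EG).2 (sub E' hE' E'F E'G).2.
Qed.

(** Edges of [F] are edges of [P] inside it, as many as its vertices; e(F) thus becomes an incidence
    count in [P]. *)
Lemma num_edges_facet S F (P := convex_hull [set` S]) : full_dim P -> facets P F ->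
  num_edges F = count (fun v => `[< F v >]) (vertex_seq P).
Proof.
move=> full fF; rewrite count_facet // -size_filter /num_edges /card_of.
apply: perm_size; apply: uniq_perm; rewrite ?filter_uniq ?edge_seq_uniq ?fset_uniq //.
move=> E; rewrite mem_filter (edges_facet fF).
have fin : finite_set [set E | edges P E /\ E `<=` F].
  by apply: sub_finite_set (finite_edges S) => ? [].
apply/idP/andP => [/(mem_fset_set _ fin)[hE EF]|[/asboolP EF /edge_seqP hE]].
  by split; [exact/asboolP|exact/edge_seqP].
exact/(mem_fset_set _ fin).
Qed.

(** * Counting antipodal pairs of vertices and of edges *)

Section Counts.
Context (S : seq V) (c : V).
Local Notation P := (convex_hull [set` S]).
Context (full : full_dim P) (symP : centrally_symmetric c P).
Local Notation rho := (point_reflection c).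
Local Notation e := (fun F => count (fun v => `[< F v >]) (vertex_seq P)).

Lemma antipodal_facet x y : antipodal P x y <-> exists F, [/\ facets P F, F x & F (rho y)].
Proof.
rewrite (antipodal_face symP); split=> [[F [hF Fx Fy]]|[F [[hF _] Fx Fy]]]; last by exists F.
by have [G fG FG] := face_sub_facet full hF; exists G; split=> //; apply: FG.
Qed.

Lemma antipodal_midpoints_facet E E' : edges P E -> edges P E' ->
  antipodal_midpoints P E E' <-> exists F, [/\ facets P F, E `<=` F & rho @` E' `<=` F].
Proof.
move=> hE hE'; have EP := face_sub hE.1.
have rE'P := face_sub (reflection_edge symP hE').1.
split=> [[m [m' [Em E'm' /antipodal_facet[F [fF Fm Fm']]]]]|[F [fF EF rE'F]]].
  exists F; split=> //; first exact: midpoint_face fF.1 EP Em Fm.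
  exact: midpoint_face fF.1 rE'P (reflection_midpoint c E'm') Fm'.
have mid D : edges P D -> exists m, midpoint_of D m.
  move=> hD; have [x [y [_ _ _ DE _]]] := edge_ends hD.
  by exists (2^-1 *: (x + y)), x, y.
have [m Em] := mid E hE; have [m' E'm'] := mid E' hE'.
exists m, m'; split=> //; apply/antipodal_facet; exists F; split=> //.
  by apply: EF; apply: midpoint_mem.
by apply: rE'F; exists m' => //; apply: midpoint_mem.
Qed.

Lemma perm_reflection_vertices : perm_eq (vertex_seq P) (map rho (vertex_seq P)).
Proof.
apply: uniq_perm; rewrite ?map_inj_uniq ?vertex_seq_uniq //.
  exact: (inv_inj (point_reflectionK c)).
move=> w; apply/idP/mapP => [/vertex_seqP vw|[w' /vertex_seqP vw' ->]].
  exists (rho w); rewrite ?point_reflectionK //.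
  by apply/vertex_seqP; apply: reflection_vertex.
by apply/vertex_seqP; apply: reflection_vertex.
Qed.

(** [count_common_facets] is summed over ordered pairs, each edge contributing the 4 ordered pairs
    of its ends. The diagonals add 2E on the left and V + 2E on the right, so V survives. *)
Lemma num_antipodal_verticesE :
  (2 * num_antipodal_vertices P + 4 * size (edge_seq P)
   = \sum_(F <- facet_seq P) e F ^ 2 + size (vertex_seq P))%N.
Proof.
pose share v w : nat := `[< exists F, [/\ facets P F, F v & F w] >].
pose mE v w := count (fun E => `[< E v >] && `[< E w >]) (edge_seq P).
pose mF v w := count (fun F => `[< F v >] && `[< F w >]) (facet_seq P).
(* Applying the symmetry to the second vertex turns antipodality into sharing a facet; the diagonal
   terms of [share] stand for the antipodal pairs of [v] and [rho v]. *)
have A2 : (2 * num_antipodal_vertices P = \sum_(v <- vertex_seq P) \sum_(w <- vertex_seq P)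
  share v w)%N.
  rewrite mul2n card_unordered_pairs; [|exact: finite_vertices|exact: antipodal_sym].
  apply: eq_bigr => v _; rewrite -/(vertex_seq P).
  rewrite -(count_sumE (fun w => `[< exists F, [/\ facets P F, F v & F w] >])).
  rewrite [RHS](permP perm_reflection_vertices) count_map; apply: eq_count => w /=;
    apply: asbool_equiv_eq.
  split=> [[_ /antipodal_facet]|h] //.
  split; last exact/antipodal_facet.
  move=> vw; have [F [[hF _] Fv]] := h; rewrite -vw.
  exact: (face_reflection_disjoint symP full hF Fv).
have off := sum_offdiag (f := fun v w => (share v w + mE v w)%N) (g := mF) (vertex_seq_uniq P).
have {off} := off (fun v w vv vw vNw => count_common_facets full
  ((vertex_seqP _ _).1 vv) ((vertex_seqP _ _).1 vw) vNw).
have -> : (\sum_(v <- vertex_seq P) \sum_(w <- vertex_seq P) (share v w + mE v w)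
    = 2 * num_antipodal_vertices P + 4 * size (edge_seq P))%N.
  under eq_bigr => v _ do rewrite big_split.
  rewrite big_split /= -A2; congr (_ + _)%N; rewrite exchange_count_sq.
  by apply: sum_const_seq => E /edge_seqP hE; rewrite count_edge_vertices.
rewrite exchange_count_sq.
have -> : (\sum_(v <- vertex_seq P) mF v v = 2 * size (edge_seq P))%N.
  rewrite -sum_facets // -exchange_count; apply: eq_bigr => v _.
  by apply: eq_count => F; rewrite andbb.
have -> : (\sum_(v <- vertex_seq P) (share v v + mE v v)
    = size (vertex_seq P) + 2 * size (edge_seq P))%N.
  rewrite big_split /=; congr (_ + _)%N.
    rewrite (sum_const_seq (k := 1%N)) ?mul1n // => v /vertex_seqP vv.
    rewrite /share asboolT //.
    by have [F fF Fv] := face_sub_facet full vv; exists F; split=> //; apply: Fv.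
  have -> : (\sum_(v <- vertex_seq P) mE v v
      = \sum_(v <- vertex_seq P) count (fun E => `[< E v >]) (edge_seq P))%N.
    by apply: eq_bigr => v _; apply: eq_count => E; rewrite andbb.
  rewrite exchange_count.
  by apply: sum_const_seq => E /edge_seqP hE; rewrite count_edge_vertices.
by move: (\sum_(F <- _) _)%N => q; lia.
Qed.

(** The same double sum over edges. On the diagonal [share] is 1 while an edge lies in two facets,
    which adds 2E on the left and E on the right. *)
Lemma num_antipodal_edgesE :
  (2 * num_antipodal_edges P + size (edge_seq P)
   = \sum_(F <- facet_seq P) e F ^ 2)%N.
Proof.
pose share E E' : nat := `[< exists F, [/\ facets P F, E `<=` F & E' `<=` F] >].
pose mF E E' := count (fun F => `[< E `<=` F >] && `[< E' `<=` F >]) (facet_seq P).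
have rhoK : involutive (fun E => rho @` E) by exact: reflection_imageK.
have B2 : (2 * num_antipodal_edges P = \sum_(E <- edge_seq P) \sum_(E' <- edge_seq P) share E
  E')%N.
  rewrite mul2n card_unordered_pairs; [|exact: finite_edges|]; last first.
    by move=> E E' [m [m' [Em E'm' /antipodal_sym h]]]; exists m', m.
  rewrite -/(edge_seq P); apply: eq_big_seq => E /edge_seqP hE.
  rewrite -(count_sumE (fun E' => `[< exists F, [/\ facets P F, E `<=` F & E' `<=` F] >])).
  have perm_rho : perm_eq (edge_seq P) (map (fun E => rho @` E) (edge_seq P)).
    apply: uniq_perm; rewrite ?map_inj_uniq ?edge_seq_uniq //.
      exact: inv_inj rhoK.
    move=> E'; apply/idP/mapP => [/edge_seqP hE'|[E'' /edge_seqP hE'' ->]].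
      exists (rho @` E'); rewrite ?reflection_imageK //.
      by apply/edge_seqP; apply: reflection_edge.
    by apply/edge_seqP; apply: reflection_edge.
  rewrite [RHS](permP perm_rho) count_map; apply: eq_in_count => E' /edge_seqP hE' /=;
    apply: asbool_equiv_eq.
  split=> [[_ /(antipodal_midpoints_facet hE hE')]|h] //.
  split; last exact/antipodal_midpoints_facet.
  move=> EE'; have [F [[hF _] EF]] := h; rewrite -EE' => rEF.
  have [x xS Ex] := face_pt hE.1.
  apply: (face_reflection_disjoint symP full hF (EF _ Ex)).
  by apply: rEF; exists x.
have off := sum_offdiag (f := share) (g := mF) (edge_seq_uniq P).
have {off} := off (fun E E' hE hE' EE' => count_common_edge_facets full
  ((edge_seqP _ _).1 hE) ((edge_seqP _ _).1 hE') EE').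
rewrite -B2 exchange_count_sq.
have -> : (\sum_(E <- edge_seq P) mF E E = 2 * size (edge_seq P))%N.
  apply: sum_const_seq => E /edge_seqP hE; rewrite -[RHS](count_edge_facets full hE).
  by apply: eq_count => F; rewrite andbb.
have -> : (\sum_(E <- edge_seq P) share E E = size (edge_seq P))%N.
  rewrite (sum_const_seq (k := 1%N)) ?mul1n // => E /edge_seqP hE.
  rewrite /share asboolT //.
  by have [F [_ [_ [fF EF] _ _]]] := edge_two_facets full hE; exists F.
have -> : (\sum_(F <- facet_seq P) count (fun E => `[< E `<=` F >]) (edge_seq P) ^ 2
    = \sum_(F <- facet_seq P) e F ^ 2)%N.
  by apply: eq_big_seq => F /facet_seqP fF; rewrite count_facet.
by move: (\sum_(F <- _) _)%N => q; lia.
Qed.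

Lemma antipodal_defectE :
  2 * antipodal_defect P = 4 * (num_edges P)%:Z - (num_facets P)%:Z :> int.
Proof.
have := num_antipodal_verticesE; have := num_antipodal_edgesE; have := euler full.
rewrite /antipodal_defect -[num_vertices P]/(size (vertex_seq P)).
rewrite -[num_edges P]/(size (edge_seq P)) -[num_facets P]/(size (facet_seq P)).
(* The sum of squares enters both identities alike: abstracted to [q], it cancels. *)
move: (\sum_(F <- _) _)%N => q; lia.
Qed.

(** Each pair consists of two distinct facets with equally many edges, so twice the sum over pairs
    is the sum over facets, whichever members [rep] picks. *)
Lemma sum_opposite_facets (rep : set (set V) -> set V) :
    (forall p, opposite_facets c P p -> p (rep p)) ->
  2 * \sum_(p \in opposite_facets c P) (2 * (num_edges (rep p))%:Z - 1)
  = 4 * (num_edges P)%:Z - (num_facets P)%:Z :> int.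
Proof.
move=> hrep; have fin : finite_set (opposite_facets c P).
  exact/finite_image/finite_facets.
rewrite fsbig_finite //=; set t : seq (set (set V)) := fset_set _.
have tP p : p \in t <-> opposite_facets c P p by exact: mem_fset_set.
have ut : uniq t by exact: fset_uniq.
have rhoE F : facets P F -> num_edges (rho @` F) = num_edges F.
  move=> fF; rewrite (num_edges_facet full fF) (num_edges_facet full (reflection_facet symP
    fF)).
  rewrite [RHS](permP perm_reflection_vertices) count_map.
  by apply: eq_count => v /=; apply: asbool_equiv_eq; apply: reflection_imageP.
have facet_neq F : facets P F -> F <> rho @` F.
  move=> [hF _] FF; have [x xS Fx] := face_pt hF.
  apply: (face_reflection_disjoint symP full hF Fx).
  by rewrite FF; exists x.
pose g F : int := 2 * (num_edges F)%:Z - 1.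
(* The edge numbers of the facets add up to 2E, each edge lying in two of them. *)
have <- : \sum_(F <- facet_seq P) g F = 4 * (num_edges P)%:Z - (num_facets P)%:Z.
  rewrite sumrB -mulr_sumr; congr (_ - _); last first.
    by rewrite big_const_seq count_predT iter_addr_0 natz.
  have -> : \sum_(F <- facet_seq P) (num_edges F)%:Z = (\sum_(F <- facet_seq P) e F)%N%:Z.
    rewrite (big_morph Posz PoszD (erefl 0%:Z)).
    by apply: eq_big_seq => F /facet_seqP fF; rewrite (num_edges_facet full fF).
  rewrite sum_facets //; rewrite -[num_edges P]/(size (edge_seq P)); lia.
rewrite (sum_fibers (t := t) (f := fun F => [set F; rho @` F]) _ ut); last first.
  by move=> F /facet_seqP fF; apply/tP; exists F.
rewrite mulr_sumr; apply: eq_big_seq => p pt.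
have pop := (tP p).1 pt; have repP := hrep _ pop.
have [frep pE] : facets P (rep p) /\ p = [set rep p; rho @` rep p].
  case: pop repP => F fF <- /=; set r := rep _ => -[->|->]; first by [].
  by split; [exact: reflection_facet|rewrite reflection_imageK setUC].
rewrite (@big_two _ _ _ _ _ (rep p) (rho @` rep p)) ?facet_seq_uniq //.
- by rewrite /g rhoE //; lia.
- exact/facet_seqP.
- by apply/facet_seqP; apply: reflection_facet.
- by apply/eqP; apply: facet_neq.
- move=> F _; apply/eqP/orP => [FE|].
    have : p F by rewrite -FE; left.
    by rewrite {1}pE => -[] /= ->; [left|right].
  by move=> [] /eqP ->; rewrite ?reflection_imageK; [|rewrite setUC]; rewrite -pE.
Qed.

End Counts.
End Defect.

(* [rep] is an arbitrary choice of a member of each pair {F, -F}: the sum does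
   not depend on which member represents the pair. *)
Theorem corollary3p5 (R : realType) (P : set 'rV[R]_3) (c : 'rV[R]_3)
    (rep : set (set 'rV[R]_3) -> set 'rV[R]_3)
    (hP : convex_polyhedron P) (hc : centrally_symmetric c P)
    (hrep : forall p, opposite_facets c P p -> p (rep p)) :
  antipodal_defect P =
    \sum_(p \in opposite_facets c P) (2 * (num_edges (rep p))%:Z - 1)
  /\ (antipodal_defect P)%:~R =
       2 * (num_edges P)%:R - (num_facets P)%:R / 2 :> rat.
Proof.
have [[A [/finite_seqP[S AS] PE]] /has_dim_full full] := hP.
rewrite AS in PE; subst P; have defect2 := antipodal_defectE full hc; split.
  apply: (mulfI (_ : 2 != 0 :> int)) => //.
  by rewrite defect2 (sum_opposite_facets full hc hrep).
have := congr1 (fun z : int => z%:~R : rat) defect2.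
rewrite rmorphM rmorphB rmorphM /= => h.
have -> : 2 * (num_edges (convex_hull [set` S]))%:R - (num_facets (convex_hull [set` S]))%:R / 2
  = (4 * (num_edges (convex_hull [set` S]))%:R - (num_facets (convex_hull [set` S]))%:R) / 2
    :> rat.
  by field.
by rewrite -h; field.
Qed.
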